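(* Let $\sigma\in S_n$ and let $\sigma=\sigma_1\cdots\sigma_m$ be its cycle decomposition (including cycles of length $1$). Denote the length of $\sigma_j$ by $i_j$ (so $i_j\ge1$ and $i_1+\cdots+i_m=n$). Then $$Tr_\sigma(Q_n,t)=\frac{1-t}{1-t\displaystyle\prod_{j=1}^m(2-t^{i_j})}.$$
   Context: Let $k$ be a field (of characteristic $0$, so that traces determine the integer coefficients below). $Q_n$ is the associative unital $k$-algebra generated by $v_A$ for nonempty $A\subseteq\{1,\dots,n\}$ (with the convention $v_\emptyset:=0$), with relations $$v_A(v_{A\setminus i}-v_{A\setminus j})-v_{A\setminus i}^2+v_{A\setminus j}^2+(v_{A\setminus i}-v_{A\setminus j})v_{A\setminus\{i,j\}}=0$$ for all $A$ with $|A|\ge2$ and distinct $i,j\in A$. It is graded by word length in the generators, $Q_n=\bigoplus_i(Q_n)_{[i]}$. The group $S_n$ acts on $Q_n$ by graded algebra automorphisms with $\sigma(v_A)=v_{\sigma(A)}$. The graded trace function is $Tr_\sigma(Q_n,t)=\sum_{i\ge0}\mathrm{Tr}\big(\sigma|_{(Q_n)_{[i]}}\big)t^i$. *)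

(* Defs.v *)
From HB Require Import structures.
From mathcomp Require Import boolp classical_sets.
From mathcomp Require Import all_boot all_fingroup all_algebra.
From mathcomp Require Import generic_quotient ring_quotient finmap monalg.

Set Implicit Arguments.
Unset Strict Implicit.
Unset Printing Implicit Defensive.

Import GRing.Theory.

Local Open Scope ring_scope.

(* Formal power series, as coefficient sequences. *)

Definition fps (R : Type) : Type := nat -> R.

HB.instance Definition _ (R : choiceType) := Choice.copy (fps R) (nat -> R).

Section FpsZmodule.
Variable R : zmodType.
Implicit Types f g : fps R.

Definition fps_zero : fps R := fun=> 0.
Definition fps_opp f : fps R := fun n => - f n.
Definition fps_add f g : fps R := fun n => f n + g n.

Fact fps_addA : associative fps_add.
Proof. by move=> f g h; apply/funext => n; rewrite /fps_add addrA. Qed.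
Fact fps_addC : commutative fps_add.
Proof. by move=> f g; apply/funext => n; rewrite /fps_add addrC. Qed.
Fact fps_add0 : left_id fps_zero fps_add.
Proof. by move=> f; apply/funext => n; rewrite /fps_add add0r. Qed.
Fact fps_addN : left_inverse fps_zero fps_opp fps_add.
Proof. by move=> f; apply/funext => n; rewrite /fps_add addNr. Qed.

HB.instance Definition _ :=
  GRing.isZmodule.Build (fps R) fps_addA fps_addC fps_add0 fps_addN.

End FpsZmodule.

Section FpsRing.
Variable R : comNzRingType.
Implicit Types f g h : fps R.

Definition fps_one : fps R := fun n => (n == 0%N)%:R.
Definition fps_mul f g : fps R := fun n => \sum_(i < n.+1) f i * g (n - i)%N.

Definition fps_trunc m f : {poly R} := \poly_(i < m) f i.

Fact fps_mul_trunc m f g n : (n < m)%N ->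
  fps_mul f g n = (fps_trunc m f * fps_trunc m g)`_n.
Proof.
move=> lt_nm; rewrite coefM; apply: eq_bigr => i _.
rewrite !coef_poly (leq_ltn_trans (leq_subr _ _) lt_nm).
by rewrite (leq_trans (ltn_ord i) lt_nm).
Qed.

Fact fps_mulC : commutative fps_mul.
Proof.
by move=> f g; apply/funext => n; rewrite !(@fps_mul_trunc n.+1) // mulrC.
Qed.

Fact fps_mulA : associative fps_mul.
Proof.
move=> f g h; apply/funext => n; pose T := fps_trunc n.+1.
transitivity (T f * (T g * T h))`_n.
  rewrite coefM; apply: eq_bigr => i _.
  rewrite (@fps_mul_trunc n.+1) ?ltnS ?leq_subr //.
  by rewrite coef_poly (ltn_ord i).
rewrite mulrA coefM; apply: eq_bigr => i _.
rewrite (@fps_mul_trunc n.+1 f g) //.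
by rewrite [(T h)`__]coef_poly ltnS leq_subr.
Qed.

Fact fps_mul1 : left_id fps_one fps_mul.
Proof.
move=> f; apply/funext => n; rewrite /fps_mul big_ord_recl mul1r subn0.
by rewrite big1 ?addr0 // => i _; rewrite mul0r.
Qed.

Fact fps_mulDl : left_distributive fps_mul (@fps_add R).
Proof.
move=> f g h; apply/funext => n; rewrite /fps_mul /fps_add -big_split /=.
by apply: eq_bigr => i _; rewrite mulrDl.
Qed.

Fact fps_oner_neq0 : fps_one != @fps_zero R.
Proof. by apply/eqP => /(congr1 (@^~ 0%N)) /eqP; rewrite oner_eq0. Qed.

HB.instance Definition _ := GRing.Zmodule_isComNzRing.Build (fps R)
  fps_mulA fps_mulC fps_mul1 fps_mulDl fps_oner_neq0.

Lemma fpsME f g n : (f * g) n = \sum_(i < n.+1) f i * g (n - i)%N.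
Proof. by []. Qed.

Definition fps_X : fps R := fun n => (n == 1%N)%:R.

End FpsRing.

Notation "''t'" := (fps_X _) (at level 0) : ring_scope.

Section FpsUnit.
Variable R : comUnitRingType.
Implicit Types f g h : fps R.

(* [fps_inv_seq f n] lists the first [n] coefficients of [1 / f], computed by
   g_n = - f_0^-1 * (f_1 * g_(n-1) + ... + f_n * g_0) for n > 0. *)
Fixpoint fps_inv_seq f n : seq R :=
  if n is m.+1 then
    let s := fps_inv_seq f m in
    rcons s ((f 0%N)^-1 * ((m == 0%N)%:R - \sum_(i < m) f (m - i)%N * s`_i))
  else [::].

Definition fps_unit : {pred fps R} := fun f => f 0%N \is a GRing.unit.
Definition fps_inv f : fps R :=
  if f 0%N \is a GRing.unit then fun n => (fps_inv_seq f n.+1)`_n else f.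

Fact size_fps_inv_seq f n : size (fps_inv_seq f n) = n.
Proof. by elim: n => //= n IHn; rewrite size_rcons IHn. Qed.

Fact nth_fps_inv_seq f m n : (n < m)%N ->
  (fps_inv_seq f m)`_n = (fps_inv_seq f n.+1)`_n.
Proof.
elim: m => // m IHm; rewrite ltnS leq_eqVlt => /orP[/eqP-> //|lt_nm].
by rewrite -IHm //= nth_rcons size_fps_inv_seq lt_nm.
Qed.

Fact fps_mulVx : {in fps_unit, left_inverse 1 fps_inv *%R}.
Proof.
move=> f f0U; apply/funext => n; rewrite fpsME /fps_inv [f 0%N \is a _]f0U.
rewrite big_ord_recr /= nth_rcons size_fps_inv_seq ltnn eqxx subnn.
rewrite mulrAC mulVr // mul1r.
rewrite [X in X + _](_ : _ = \sum_(i < n) f (n - i)%N * (fps_inv_seq f n)`_i).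
  by rewrite addrC subrK.
by apply: eq_bigr => i _; rewrite mulrC -(@nth_fps_inv_seq f n).
Qed.

Fact fps_unitPl f g : g * f = 1 -> fps_unit f.
Proof.
move=> /(congr1 (@^~ 0%N)); rewrite fpsME big_ord_recl big_ord0 addr0 subn0 => gf.
by apply/unitrPr; exists (g 0%N); rewrite mulrC.
Qed.

Fact fps_invr_out : {in [predC fps_unit], fps_inv =1 id}.
Proof. by move=> f /negbTE f0U; rewrite /fps_inv [f 0%N \is a _]f0U. Qed.

HB.instance Definition _ := GRing.ComNzRing_hasMulInverse.Build (fps R)
  fps_mulVx fps_unitPl fps_invr_out.

Lemma fps_unitE f : (f \is a GRing.unit) = (f 0%N \is a GRing.unit).
Proof. by []. Qed.

End FpsUnit.

Section Trace.
Variables (k : fieldType) (V : lmodType k).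
Implicit Types (U : set V) (f : V -> V).

Definition is_basis U m (b : 'I_m -> V) : Prop :=
  [/\ forall i, U (b i),
      forall x, U x -> exists c : 'rV[k]_m, x = \sum_i c 0 i *: b i
    & forall c : 'rV[k]_m, \sum_i c 0 i *: b i = 0 -> c = 0].

(* Row convention: row [i] of [M] holds the coordinates of [f (b i)]. *)
Definition is_matrix_in f m (b : 'I_m -> V) (M : 'M[k]_m) : Prop :=
  forall i, f (b i) = \sum_j M i j *: b j.

Definition is_trace U f (a : k) : Prop :=
  exists m (b : 'I_m -> V) (M : 'M[k]_m),
    [/\ is_basis U b, is_matrix_in f b M & a = \tr M].

(* For [U] a finite-dimensional subspace stable under a linear [f]; by
   [trace_onE] the value does not depend on the basis. Defaults to [0]. *)
Definition trace_on U f : k := xget 0 (is_trace U f).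

Lemma trace_onE U (f : {linear V -> V}) m (b : 'I_m -> V) (M : 'M[k]_m) :
  is_basis U b -> is_matrix_in f b M -> trace_on U f = \tr M.
Proof.
move=> bU fM.
have /(xgetPex 0) : exists a, is_trace U f a by exists (\tr M), m, b, M.
rewrite -/(trace_on U f) => -[m' [b' [M' [b'U fM' ->]]]].
have change p q (e : 'I_p -> V) (e' : 'I_q -> V) :
    is_basis U e -> is_basis U e' ->
    exists P : 'M[k]_(p, q), forall i, e i = \sum_j P i j *: e' j.
  move=> [eU _ _] [_ e'U _].
  pose c i := sval (cid (e'U _ (eU i))).
  exists (\matrix_(i, j) c i 0 j) => i; rewrite (svalP (cid (e'U _ (eU i)))).
  by apply: eq_bigr => j _; rewrite mxE.
have comb p q r (e : 'I_r -> V) (A : 'M[k]_(p, q)) (B : 'M[k]_(q, r)) i :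
    \sum_j A i j *: (\sum_l B j l *: e l) = \sum_l (A *m B) i l *: e l.
  under eq_bigr do rewrite scaler_sumr.
  rewrite exchange_big; apply: eq_bigr => l _.
  rewrite mxE scaler_suml; apply: eq_bigr => j _; by rewrite scalerA.
have uniq p q (e : 'I_q -> V) (A B : 'M[k]_(p, q)) : is_basis U e ->
    (forall i, \sum_j A i j *: e j = \sum_j B i j *: e j) -> A = B.
  move=> [_ _ free] AB; apply/row_matrixP => i; apply/eqP.
  rewrite -subr_eq0; apply/eqP/free.
  under eq_bigr do rewrite !mxE scalerBl.
  by rewrite sumrB AB subrr.
have sum1 p (e : 'I_p -> V) i : e i = \sum_j (1%:M : 'M[k]_p) i j *: e j.
  rewrite (bigD1 i) //= mxE eqxx scale1r big1 ?addr0 // => j ji.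
  by rewrite mxE eq_sym (negbTE ji) scale0r.
have [P bP] := change _ _ _ _ bU b'U.
have [P' b'P] := change _ _ _ _ b'U bU.
have PP' : P *m P' = 1%:M.
  apply: (uniq _ _ b) => // i; rewrite -sum1 -comb [RHS]bP.
  by apply: eq_bigr => j _; rewrite -b'P.
have -> : M' = P' *m (M *m P).
  apply: (uniq _ _ b') => // i; rewrite -fM' b'P linear_sum -comb.
  apply: eq_bigr => j _; rewrite linearZ /= fM -comb.
  by under [in LHS]eq_bigr do rewrite bP.
by rewrite mxtrace_mulC -mulmxA PP' mulmx1.
Qed.

End Trace.

Definition freeAlg (k : comNzRingType) (G : choiceType) : Type :=
  {malg k[{fmonom G}]}.

Section FreeAlg.
Variables (k : comNzRingType) (G : choiceType).

HB.instance Definition _ := GRing.Lalgebra.on (freeAlg k G).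

Fact freeAlg_scaleAr (a : k) (x y : freeAlg k G) : a *: (x * y) = x * (a *: y).
Proof.
have cent (z : {malg k[{fmonom G}]}) : z * a%:MP = a *: z.
  rewrite -mul_malgC !malgM_def fgmulUg fgmulgU; apply: eq_bigr => w _.
  by rewrite mul1m mulm1 mulrC.
have -> : a *: y = a%:MP * y by rewrite mul_malgC.
by rewrite mulrA (cent x) scalerAl.
Qed.

HB.instance Definition _ :=
  GRing.Lalgebra_isAlgebra.Build k (freeAlg k G) freeAlg_scaleAr.

Definition free_gen (g : G) : freeAlg k G := << fmu g >>%R.

End FreeAlg.

Section FreeLift.
Variables (k : comNzRingType) (G : choiceType) (A : algType k) (v : G -> A).
Implicit Types x y : freeAlg k G.

(* The algebra morphism determined by [free_gen g |-> v g]. *)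
Definition free_lift x : A :=
  \sum_(w <- msupp x) (x : {malg k[{fmonom G}]})@_w *: \prod_(g <- w) v g.

Fact free_liftEw (d : {fset {fmonom G}}) x : (msupp x `<=` d)%fset ->
  free_lift x = \sum_(w <- d) (x : {malg k[{fmonom G}]})@_w *: \prod_(g <- w) v g.
Proof.
move=> le; rewrite /free_lift (big_fset_incl _ le) => //= w _ /mcoeff_outdom ->.
by rewrite scale0r.
Qed.

Fact free_liftU (c : k) (w : {fmonom G}) :
  free_lift << c *g w >> = c *: \prod_(g <- w) v g.
Proof. by rewrite (free_liftEw msuppU_le) big_seq_fset1 mcoeffUU. Qed.

Fact free_lift_is_linear : linear free_lift.
Proof.
move=> a x y; pose d := (msupp x `|` msupp y)%fset.
have xd : (msupp x `<=` d)%fset by apply: fsubsetUl.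
have yd : (msupp y `<=` d)%fset by apply: fsubsetUr.
have axyd : (msupp (a *: x + y) `<=` d)%fset.
  apply: fsubset_trans (msuppD_le _ _) _; rewrite fsubUset yd andbT.
  exact: fsubset_trans (msuppZ_le _ _) xd.
rewrite (free_liftEw xd) (free_liftEw yd) (free_liftEw axyd) scaler_sumr.
rewrite -big_split /=; apply: eq_bigr => w _.
by rewrite mcoeffD mcoeffZ scalerDl scalerA.
Qed.

HB.instance Definition _ :=
  GRing.isLinear.Build k (freeAlg k G) A _ free_lift free_lift_is_linear.

Fact free_lift_is_monoid_morphism : monoid_morphism free_lift.
Proof.
split=> [|x y]; first by rewrite free_liftU scale1r fm1 big_nil.
rewrite [x * y]malgME linear_sum mulr_suml; apply: eq_bigr => w _.
rewrite linear_sum mulr_sumr; apply: eq_bigr => w' _.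
by rewrite /= free_liftU fmM big_cat /= -scalerAl -scalerAr scalerA.
Qed.

HB.instance Definition _ :=
  GRing.isMonoidMorphism.Build (freeAlg k G) A free_lift
    free_lift_is_monoid_morphism.

Lemma free_lift_gen g : free_lift (free_gen k g) = v g.
Proof. by rewrite free_liftU scale1r fmU big_seq1. Qed.

End FreeLift.

Section GeneratedIdeal.
Variables (k : comNzRingType) (A : algType k).
Implicit Types (I : set A) (rels : set A).

Definition two_sided_ideal I : Prop :=
  [/\ I 0, forall x y, I x -> I y -> I (x - y)
    & forall a b x, I x -> I (a * x * b)].

Definition gen_ideal rels : {pred A} :=
  fun x => `[< forall I, two_sided_ideal I -> (rels `<=` I)%classic -> I x >].

Lemma gen_idealP rels x :
  reflect (forall I, two_sided_ideal I -> (rels `<=` I)%classic -> I x)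
          (x \in gen_ideal rels).
Proof. exact: asboolP. Qed.

Fact gen_ideal_zmod_closed rels : zmod_closed (gen_ideal rels).
Proof.
split=> [|x y /gen_idealP Ix /gen_idealP Iy]; apply/gen_idealP => I idI relsI.
  by case: idI.
by have [_ + _] := idI; apply; [apply: Ix | apply: Iy].
Qed.

HB.instance Definition _ rels :=
  GRing.isZmodClosed.Build A (gen_ideal rels) (gen_ideal_zmod_closed rels).

Lemma gen_ideal_rel rels x : rels x -> x \in gen_ideal rels.
Proof. by move=> rx; apply/gen_idealP => I _; apply. Qed.

Lemma gen_idealM rels a b x : x \in gen_ideal rels -> a * x * b \in gen_ideal rels.
Proof.
move=> /gen_idealP Ix; apply/gen_idealP => I idI relsI.
by have [_ _] := idI; apply; apply: Ix.
Qed.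

Lemma gen_idealZ rels (c : k) x : x \in gen_ideal rels -> c *: x \in gen_ideal rels.
Proof.
have -> : c *: x = c%:A * x * 1 by rewrite mulr1 -scalerAl mul1r.
exact: gen_idealM.
Qed.

End GeneratedIdeal.

Section QuotientAlgebra.
Variables (k : comNzRingType) (A : algType k) (rels : set A).
Local Open Scope quotient_scope.

Definition quotAlg : Type := Quotient.quot (gen_ideal rels).

HB.instance Definition _ := GRing.Zmodule.on quotAlg.
HB.instance Definition _ := ZmodQuotient.on quotAlg.

Definition quot_pi (x : A) : quotAlg := \pi_quotAlg x.

Lemma quot_piP x y : (quot_pi x = quot_pi y) <-> (x - y \in gen_ideal rels).
Proof.
rewrite (Quotient.idealrBE (gen_ideal rels)); split=> [e|/eqP //].
exact/eqP.
Qed.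

Lemma quot_piK (q : quotAlg) : quot_pi (repr q) = q.
Proof. exact: reprK. Qed.

Fact quot_piB : {morph quot_pi : x y / x - y}.
Proof. exact: (@pi_is_zmod_morphism A _ 0 (Quotient.quot (gen_ideal rels))). Qed.

Fact quot_piD : {morph quot_pi : x y / x + y}.
Proof. exact: pi_addr. Qed.

Definition quot_one : quotAlg := quot_pi 1.
Definition quot_mul (p q : quotAlg) : quotAlg := quot_pi (repr p * repr q).
Definition quot_scale (c : k) (q : quotAlg) : quotAlg := quot_pi (c *: repr q).

Fact quot_mulE x y : quot_mul (quot_pi x) (quot_pi y) = quot_pi (x * y).
Proof.
apply/quot_piP.
set x' := repr _; set y' := repr _.
have Ix : x' - x \in gen_ideal rels by apply/quot_piP; rewrite quot_piK.
have Iy : y' - y \in gen_ideal rels by apply/quot_piP; rewrite quot_piK.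
have -> : x' * y' - x * y = 1 * (x' - x) * y' + x * (y' - y) * 1.
  by rewrite mul1r mulr1 mulrBl mulrBr addrA subrK.
by rewrite rpredD ?gen_idealM.
Qed.

Fact quot_scaleE c x : quot_scale c (quot_pi x) = quot_pi (c *: x).
Proof.
by apply/quot_piP; rewrite -scalerBr gen_idealZ //; apply/quot_piP/quot_piK.
Qed.

Fact quot_ind (P : quotAlg -> Prop) : (forall x, P (quot_pi x)) -> forall q, P q.
Proof. by move=> Px q; rewrite -(quot_piK q). Qed.

Fact quot_mulA : associative quot_mul.
Proof.
elim/quot_ind=> x; elim/quot_ind=> y; elim/quot_ind=> z.
by rewrite !quot_mulE mulrA.
Qed.
Fact quot_mul1 : left_id quot_one quot_mul.
Proof. by elim/quot_ind=> x; rewrite quot_mulE mul1r. Qed.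
Fact quot_mulr1 : right_id quot_one quot_mul.
Proof. by elim/quot_ind=> x; rewrite quot_mulE mulr1. Qed.
Fact quot_mulDl : left_distributive quot_mul +%R.
Proof.
elim/quot_ind=> x; elim/quot_ind=> y; elim/quot_ind=> z.
by rewrite -quot_piD !quot_mulE mulrDl quot_piD.
Qed.
Fact quot_mulDr : right_distributive quot_mul +%R.
Proof.
elim/quot_ind=> x; elim/quot_ind=> y; elim/quot_ind=> z.
by rewrite -quot_piD !quot_mulE mulrDr quot_piD.
Qed.

HB.instance Definition _ := GRing.Zmodule_isPzRing.Build quotAlg
  quot_mulA quot_mul1 quot_mulr1 quot_mulDl quot_mulDr.

Fact quot_scaleA a b q : quot_scale a (quot_scale b q) = quot_scale (a * b) q.
Proof. by elim/quot_ind: q => x; rewrite !quot_scaleE scalerA. Qed.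
Fact quot_scale1 : left_id 1 quot_scale.
Proof. by elim/quot_ind=> x; rewrite quot_scaleE scale1r. Qed.
Fact quot_scaleDr : right_distributive quot_scale +%R.
Proof.
move=> a; elim/quot_ind=> x; elim/quot_ind=> y.
by rewrite -quot_piD !quot_scaleE scalerDr quot_piD.
Qed.
Fact quot_scaleDl q : {morph quot_scale^~ q : a b / a + b}.
Proof.
by move=> a b; elim/quot_ind: q => x; rewrite !quot_scaleE scalerDl quot_piD.
Qed.

HB.instance Definition _ := GRing.Zmodule_isLmodule.Build k quotAlg
  quot_scaleA quot_scale1 quot_scaleDr quot_scaleDl.

Fact quot_scaleAl (c : k) (p q : quotAlg) : c *: (p * q) = (c *: p) * q.
Proof.
suff: quot_scale c (quot_mul p q) = quot_mul (quot_scale c p) q by [].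
elim/quot_ind: p => x; elim/quot_ind: q => y.
by rewrite quot_scaleE !quot_mulE quot_scaleE scalerAl.
Qed.

Fact quot_scaleAr (c : k) (p q : quotAlg) : c *: (p * q) = p * (c *: q).
Proof.
suff: quot_scale c (quot_mul p q) = quot_mul p (quot_scale c q) by [].
elim/quot_ind: p => x; elim/quot_ind: q => y.
by rewrite quot_scaleE !quot_mulE quot_scaleE scalerAr.
Qed.

Fact quot_pi_is_linear : linear quot_pi.
Proof. by move=> a x y; rewrite quot_piD -quot_scaleE. Qed.
HB.instance Definition _ :=
  GRing.isLinear.Build k A quotAlg _ quot_pi quot_pi_is_linear.

Fact quot_pi_is_monoid_morphism : monoid_morphism quot_pi.
Proof. by split=> // x y; rewrite -quot_mulE. Qed.
HB.instance Definition _ :=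
  GRing.isMonoidMorphism.Build A quotAlg quot_pi quot_pi_is_monoid_morphism.

End QuotientAlgebra.

(* The morphism [quotAlg rels -> B] induced by a morphism [A -> B] that
   vanishes on [rels] (see [quot_liftE]). *)
Section QuotientLift.
Variables (k : comNzRingType) (A B : algType k) (rels : set A).
Variable f : {lrmorphism A -> B}.
Hypothesis f_rels : forall x, rels x -> f x = 0.

Definition quot_lift (q : quotAlg rels) : B := f (repr q).

Lemma quot_liftE x : quot_lift (quot_pi rels x) = f x.
Proof.
apply/eqP; rewrite -subr_eq0 -rmorphB; apply/eqP.
set z := _ - x; have /gen_idealP : z \in gen_ideal rels.
  by apply/quot_piP; rewrite quot_piK.
move=> /(_ (fun y => f y = 0)); apply; last exact: f_rels.
split=> [|u w fu fw|a b u fu]; first exact: rmorph0.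
  by rewrite raddfB /= fu fw subrr.
by rewrite !rmorphM /= fu mulr0 mul0r.
Qed.

End QuotientLift.

Fact rmorph_relator (A B : pzRingType) (f : {rmorphism A -> B}) (x y z w : A) :
  f (x * (y - z) - y ^+ 2 + z ^+ 2 + (y - z) * w) =
    f x * (f y - f z) - f y ^+ 2 + f z ^+ 2 + (f y - f z) * f w.
Proof. by rewrite 2!rmorphD rmorphB !rmorphXn !rmorphM !rmorphB. Qed.

Section Qn.
Variables (k : fieldType) (n : nat).

Definition Qgen : Type := {A : {set 'I_n} | A != set0}.
HB.instance Definition _ := Finite.on Qgen.

(* The generator [v_A], with the convention that [v_A = 0] for empty [A]. *)
Definition Qfree_v (A : {set 'I_n}) : freeAlg k Qgen :=
  if insub A is Some g then free_gen k g else 0.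

Local Notation v := Qfree_v.

Inductive Qrel : set (freeAlg k Qgen) :=
  QRel (A : {set 'I_n}) (i j : 'I_n) of
      (2 <= #|A|)%N & i \in A & j \in A & i != j :
    Qrel (v A * (v (A :\ i) - v (A :\ j))
          - v (A :\ i) ^+ 2 + v (A :\ j) ^+ 2
          + (v (A :\ i) - v (A :\ j)) * v (A :\: [set i; j])).

Definition Qn : Type := quotAlg Qrel.

HB.instance Definition _ := GRing.PzRing.on Qn.
HB.instance Definition _ := GRing.Lmodule.on Qn.

Fact Qn_oner_neq0 : (1 : Qn) != 0.
Proof.
apply/eqP => e; have /gen_idealP : (1 : freeAlg k Qgen) \in gen_ideal Qrel.
  by have := (quot_piP Qrel 1 0).1 (etrans e (esym (raddf0 _))); rewrite subr0.
have [f fv] : exists f : {lrmorphism freeAlg k Qgen -> k^o},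
    forall A, f (Qfree_v A) = 0.
  exists (@free_lift k Qgen k^o (fun=> 0)) => A; rewrite /Qfree_v.
  by case: insubP => [g _ _|_] /=; [exact: free_lift_gen | exact: raddf0].
move=> /(_ (fun x => f x = 0)) f0; suff: f 1 = 0.
  by rewrite rmorph1 => /eqP; rewrite oner_eq0.
apply: f0 => [|_ [A i j _ _ _ _] /=].
  split=> [|x y fx fy|a b x fx]; first exact: raddf0.
    by rewrite raddfB /= fx fy subrr.
  by rewrite !rmorphM /= fx mulr0 mul0r.
by rewrite rmorph_relator /= !fv subrr mul0r !(mulr0, expr0n) subrr !addr0.
Qed.

HB.instance Definition _ := GRing.PzSemiRing_isNonZero.Build Qn Qn_oner_neq0.
HB.instance Definition _ :=
  GRing.Lmodule_isLalgebra.Build k Qn (@quot_scaleAl _ _ Qrel).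
HB.instance Definition _ :=
  GRing.Lalgebra_isAlgebra.Build k Qn (@quot_scaleAr _ _ Qrel).

Definition Qv (A : {set 'I_n}) : Qn := quot_pi Qrel (Qfree_v A).

(* The span of the words of length [d] in the generators. *)
Definition Qdeg (d : nat) : set Qn :=
  fun x => exists c : d.-tuple Qgen -> k,
    x = \sum_w c w *: \prod_(g <- w) Qv (val g).

Lemma Qv0 : Qv finset.set0 = 0.
Proof. by rewrite /Qv /Qfree_v insubN ?eqxx ?raddf0. Qed.

Lemma Qv_gen (g : Qgen) : Qv (val g) = quot_pi Qrel (free_gen k g).
Proof. by rewrite /Qv /Qfree_v valK. Qed.

Lemma Qv_rel (A : {set 'I_n}) i j :
    (2 <= #|A|)%N -> i \in A -> j \in A -> i != j ->
  Qv A * (Qv (A :\ i) - Qv (A :\ j)) - Qv (A :\ i) ^+ 2 + Qv (A :\ j) ^+ 2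
    + (Qv (A :\ i) - Qv (A :\ j)) * Qv (A :\: [set i; j]) = 0.
Proof.
move=> A2 iA jA ij; have /gen_ideal_rel := QRel A2 iA jA ij.
rewrite -[X in X \in _]subr0 => /quot_piP.
by rewrite rmorph_relator raddf0.
Qed.

End Qn.

Section Action.
Variables (k : fieldType) (n : nat) (s : {perm 'I_n}).
Local Notation Q := (Qn k n).
Local Notation v := (@Qv k n).

Definition Qact_free : freeAlg k (Qgen n) -> Q :=
  free_lift (fun g : Qgen n => v (s @: val g)).

HB.instance Definition _ := GRing.LRMorphism.on Qact_free.

Fact Qact_free_v A : Qact_free (Qfree_v k A) = v (s @: A).
Proof.
rewrite /Qfree_v; case: insubP => [g _ <-|]; first exact: free_lift_gen.
by rewrite negbK => /eqP->; rewrite raddf0 imset0 Qv0.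
Qed.

Fact Qact_free_rel x : Qrel x -> Qact_free x = 0.
Proof.
case=> A i j A2 iA jA ij.
have sD (B C : {set 'I_n}) : s @: (B :\: C) = (s @: B) :\: (s @: C).
  apply/setP => l; rewrite -[l](permKV s) inE.
  by rewrite !(mem_imset _ _ (@perm_inj _ s)) inE.
rewrite rmorph_relator /= !Qact_free_v !sD imsetU1 !imset_set1.
apply: Qv_rel; rewrite ?card_imset ?imset_f //; try exact: perm_inj.
by rewrite (inj_eq perm_inj).
Qed.

(* The algebra endomorphism with [v A |-> v (s @: A)], see [Qact_v]. *)
Definition Qact : Q -> Q := quot_lift Qact_free.

Fact Qact_pi x : Qact (quot_pi _ x) = Qact_free x.
Proof. exact: quot_liftE Qact_free_rel x. Qed.

Fact Qact_is_linear : linear Qact.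
Proof.
move=> a; elim/quot_ind=> x; elim/quot_ind=> y.
have E : a *: quot_pi _ x + quot_pi _ y = quot_pi (@Qrel k n) (a *: x + y).
  exact: esym (quot_pi_is_linear (@Qrel k n) a x y).
transitivity (Qact_free (a *: x + y)); first by rewrite -Qact_pi -E.
by rewrite (Qact_pi x) (Qact_pi y); exact: (linearP Qact_free a x y).
Qed.

Fact Qact_is_monoid_morphism : monoid_morphism Qact.
Proof.
split=> [|]; first by rewrite [LHS](Qact_pi 1) rmorph1.
elim/quot_ind=> x; elim/quot_ind=> y.
by rewrite -rmorphM !Qact_pi rmorphM.
Qed.

HB.instance Definition _ := GRing.isLinear.Build k Q Q _ Qact Qact_is_linear.
HB.instance Definition _ :=
  GRing.isMonoidMorphism.Build Q Q Qact Qact_is_monoid_morphism.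

Lemma Qact_v A : Qact (v A) = v (s @: A).
Proof. exact: etrans (Qact_pi _) (Qact_free_v A). Qed.

(* The coefficient of [t^d] is the trace of [s] on the degree [d] component. *)
Definition graded_trace : fps k := fun d => trace_on (@Qdeg k n d) Qact.

End Action.

(* Main.v *)
(* Put e(A,i) = v_A - v_{A\i}. The relations say that the product of the factors
   1 - e X along a chain of subsets from A down to C depends only on A and C.
   Let a(A,j) be the coefficients of P_A, the product from A down to the empty
   set; S_n permutes them.
   If C is a subset of A with |A \ C| = j, then P_A P_C^-1 has degree j, which
   rewrites a(A,j) a(C,l); hence the words in the a(A,j), 1 <= j <= |A|, without
   such consecutive pairs span Q_n.
   On the other hand, let x(m,B) = v_{m |: B} - v_B for m above B. Then Q_n acts
   on the space with basis the words avoiding all x(m,B) x(m,D)^r, where D is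
   proper in B and r = |B \ D|, in such a way that each of these words sends the
   empty word to itself; hence these words are independent in Q_n.
   Both families have the generating series (1 - t) / (1 - t (2 - t)^n), so the
   first one is a basis. It is permuted by s, and the trace counts the words
   fixed by s, namely those whose sets are unions of cycles of s; an inversion
   over the sets of cycles gives their generating series. *)

Require Import Defs.
From HB Require Import structures.
From mathcomp Require Import boolp.
From mathcomp Require Import all_boot all_fingroup all_algebra.
From mathcomp Require Import finmap monalg zify ring.

Set Implicit Arguments.
Unset Strict Implicit.
Unset Printing Implicit Defensive.

Import GRing.Theory.

Local Open Scope ring_scope.

(** * Spans and algebras of endomorphisms *)

Section Span.
Variables (k : nzRingType) (V : lmodType k).
Implicit Types (S : V -> Prop) (x y : V).

(** Adding one scaled generator at a time gives an induction principle that reduces linear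
    statements to generators. *)
Inductive span S : V -> Prop :=
| span0 : span S 0
| span_cons c x y of S x & span S y : span S (c *: x + y).

Lemma span_gen S x : S x -> span S x.
Proof. by move=> Sx; rewrite -[x]scale1r -[_ *: _]addr0;
  apply: span_cons => //; apply: span0. Qed.

Lemma spanD S x y : span S x -> span S y -> span S (x + y).
Proof.
move=> + Sy; elim=> [|c u v Su _ IH]; first by rewrite add0r.
by rewrite -addrA; apply: span_cons.
Qed.

Lemma spanZ S c x : span S x -> span S (c *: x).
Proof.
elim=> [|c' u v Su _ IH]; first by rewrite scaler0; apply: span0.
by rewrite scalerDr scalerA; apply: span_cons.
Qed.

Lemma spanN S x : span S x -> span S (- x).
Proof. by rewrite -scaleN1r; apply: spanZ. Qed.

Lemma spanB S x y : span S x -> span S y -> span S (x - y).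
Proof. by move=> Sx Sy; apply/spanD/spanN. Qed.

Lemma span_sum S (I : Type) (r : seq I) (P : pred I) (F : I -> V) :
  (forall i, P i -> span S (F i)) -> span S (\sum_(i <- r | P i) F i).
Proof. by move=> SF; apply: big_ind => //; [apply: span0 | apply: spanD]. Qed.

End Span.

Lemma span_lin (k : nzRingType) (V W : lmodType k) (S : V -> Prop)
    (S' : W -> Prop) (f : V -> W) : linear f ->
  (forall x, S x -> span S' (f x)) -> forall x, span S x -> span S' (f x).
Proof.
move=> lin_f Sf x; have f0 : f 0 = 0.
  have := lin_f (-1) 0 0; rewrite scaler0 addr0 => ->.
  by rewrite scaleN1r addNr.
elim=> [|c u v Su _ IH]; first by rewrite f0; apply: span0.
by rewrite lin_f; apply: spanD => //; apply/spanZ/Sf.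
Qed.

Lemma span_sub (k : nzRingType) (V : lmodType k) (S S' : V -> Prop) (x : V) :
  (forall y, S y -> span S' y) -> span S x -> span S' x.
Proof. by move=> SS'; apply: (@span_lin _ _ _ _ _ id) => //. Qed.

Section EndoAlgebra.
Variables (k : comNzRingType) (V : lmodType k).

(** Linearity is stored as a boolean, so proof irrelevance makes endomorphisms with equal functions
    equal. *)
Record endo := Endo { endo_fun :> V -> V; _ : `[< linear endo_fun >] }.

HB.instance Definition _ := [isSub for endo_fun].
HB.instance Definition _ := gen_eqMixin endo.
HB.instance Definition _ := gen_choiceMixin endo.

Implicit Types f g h : endo.

Lemma endoP f : linear f. Proof. by case: f => f lin_f; exact: (asboolW lin_f). Qed.

HB.instance Definition _ f := GRing.isLinear.Build k V V _ (endo_fun f) (endoP f).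

Definition mk_endo (f : V -> V) (lin_f : linear f) : endo :=
  Endo (introT (asboolP _) lin_f).

Lemma endo_ext f g : (forall x, f x = g x) -> f = g.
Proof. by move=> e; apply: val_inj; apply/funext => x; apply: e. Qed.

Fact endo0_lin : linear (fun _ : V => 0 : V).
Proof. by move=> a x y; rewrite scaler0 addr0. Qed.
Fact endo1_lin : linear (id : V -> V). Proof. by []. Qed.
Fact endoN_lin f : linear (fun x => - f x).
Proof. by move=> a x y; rewrite linearP opprD scalerN. Qed.
Fact endoD_lin f g : linear (fun x => f x + g x).
Proof. by move=> a x y; rewrite !linearP scalerDr addrACA. Qed.
Fact endoM_lin f g : linear (fun x => f (g x)).
Proof. by move=> a x y; rewrite !linearP. Qed.
Fact endoZ_lin a f : linear (fun x => a *: f x).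
Proof. by move=> b x y; rewrite linearP scalerDr !scalerA mulrC. Qed.

Definition endo0 := mk_endo endo0_lin.
Definition endo1 := mk_endo endo1_lin.
Definition endoN f := mk_endo (endoN_lin f).
Definition endoD f g := mk_endo (endoD_lin f g).
Definition endoM f g := mk_endo (endoM_lin f g).
Definition endoZ a f := mk_endo (endoZ_lin a f).

Fact endoDA : associative endoD.
Proof. by move=> f g h; apply: endo_ext => x; rewrite /= addrA. Qed.
Fact endoDC : commutative endoD.
Proof. by move=> f g; apply: endo_ext => x; rewrite /= addrC. Qed.
Fact endo0D : left_id endo0 endoD.
Proof. by move=> f; apply: endo_ext => x; rewrite /= add0r. Qed.
Fact endoND : left_inverse endo0 endoN endoD.
Proof. by move=> f; apply: endo_ext => x; rewrite /= addNr. Qed.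

HB.instance Definition _ := GRing.isZmodule.Build endo endoDA endoDC endo0D endoND.

Fact endoMA : associative endoM.
Proof. by move=> f g h; apply: endo_ext. Qed.
Fact endo1M : left_id endo1 endoM. Proof. by move=> f; apply: endo_ext. Qed.
Fact endoM1 : right_id endo1 endoM. Proof. by move=> f; apply: endo_ext. Qed.
Fact endoMDl : left_distributive endoM +%R.
Proof. by move=> f g h; apply: endo_ext. Qed.
Fact endoMDr : right_distributive endoM +%R.
Proof. by move=> f g h; apply: endo_ext => x; rewrite /= linearD. Qed.

HB.instance Definition _ := GRing.Zmodule_isPzRing.Build endo
  endoMA endo1M endoM1 endoMDl endoMDr.

Fact endoZA a b f : endoZ a (endoZ b f) = endoZ (a * b) f.
Proof. by apply: endo_ext => x; rewrite /= scalerA. Qed.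
Fact endo1Z : left_id 1 endoZ.
Proof. by move=> f; apply: endo_ext => x; rewrite /= scale1r. Qed.
Fact endoZDr : right_distributive endoZ +%R.
Proof. by move=> a f g; apply: endo_ext => x; rewrite /= scalerDr. Qed.
Fact endoZDl f : {morph endoZ^~ f : a b / a + b}.
Proof. by move=> a b; apply: endo_ext => x; rewrite /= scalerDl. Qed.

HB.instance Definition _ := GRing.Zmodule_isLmodule.Build k endo
  endoZA endo1Z endoZDr endoZDl.

Lemma endo0E x : (0 : endo) x = 0. Proof. by []. Qed.
Lemma endo1E x : (1 : endo) x = x. Proof. by []. Qed.
Lemma endoDE f g x : (f + g) x = f x + g x. Proof. by []. Qed.
Lemma endoNE f x : (- f) x = - f x. Proof. by []. Qed.
Lemma endoBE f g x : (f - g) x = f x - g x. Proof. by []. Qed.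
Lemma endoME f g x : (f * g) x = f (g x). Proof. by []. Qed.
Lemma endoZE a f x : (a *: f) x = a *: f x. Proof. by []. Qed.
Lemma endo_sumE (I : Type) (r : seq I) (P : pred I) (F : I -> endo) x :
  (\sum_(i <- r | P i) F i) x = \sum_(i <- r | P i) F i x.
Proof. by elim/big_rec2: _ => //= i y f _ <-. Qed.

Lemma endo_lin f a x y : f (a *: x + y) = a *: f x + f y.
Proof. exact: linearP. Qed.
Lemma endo_fun0 f : f 0 = 0. Proof. exact: linear0. Qed.
Lemma endo_funD f x y : f (x + y) = f x + f y. Proof. exact: linearD. Qed.
Lemma endo_funN f x : f (- x) = - f x. Proof. exact: linearN. Qed.
Lemma endo_funB f x y : f (x - y) = f x - f y. Proof. exact: linearB. Qed.
Lemma endo_funZ f a x : f (a *: x) = a *: f x. Proof. exact: linearZ. Qed.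
Lemma endo_fun_sum f (I : Type) (r : seq I) (P : pred I) (F : I -> V) :
  f (\sum_(i <- r | P i) F i) = \sum_(i <- r | P i) f (F i).
Proof. exact: linear_sum. Qed.

Lemma endo_eq_span (S : V -> Prop) f g : (forall x, S x -> f x = g x) ->
  forall x, span S x -> f x = g x.
Proof.
move=> fg x; elim=> [|c u v Su _ IH]; first by rewrite !endo_fun0.
by rewrite !endo_lin IH fg.
Qed.

End EndoAlgebra.

Arguments endo_fun : simpl never.

Section NonzeroEndo.
Variables (k : comNzRingType) (V : lmodType k) (x : V).

(** A nonzero vector recorded in the type witnesses [1 != 0], which the algebra structure
    demands. *)
Definition nz_endo (_ : x != 0) : Type := endo V.

Hypothesis x0 : x != 0.

HB.instance Definition _ := GRing.PzRing.on (nz_endo x0).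
HB.instance Definition _ := GRing.Lmodule.on (nz_endo x0).

Fact nz_endo_oner_neq0 : (1 : nz_endo x0) != 0.
Proof. by apply: contra_neq x0 => /(congr1 (fun f : endo V => f x)). Qed.

HB.instance Definition _ :=
  GRing.PzSemiRing_isNonZero.Build (nz_endo x0) nz_endo_oner_neq0.

Fact nz_endo_scaleAl (a : k) (f g : nz_endo x0) : a *: (f * g) = (a *: f) * g.
Proof. exact: endo_ext. Qed.

HB.instance Definition _ :=
  GRing.Lmodule_isLalgebra.Build k (nz_endo x0) nz_endo_scaleAl.

Fact nz_endo_scaleAr (a : k) (f g : nz_endo x0) : a *: (f * g) = f * (a *: g).
Proof.
by apply: endo_ext => y; rewrite endoZE !endoME endoZE endo_funZ.
Qed.

HB.instance Definition _ :=
  GRing.Lalgebra_isAlgebra.Build k (nz_endo x0) nz_endo_scaleAr.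

End NonzeroEndo.

(** * Linear maps out of a free module *)

Section WordModule.
Variables (k : comNzRingType) (K : choiceType).
Local Notation N := {malg k[K]}.


Section LinearExtension.
Variables (W : lmodType k) (f : K -> W).

Definition lext (x : N) : W := \sum_(w <- msupp x) x@_w *: f w.

Lemma lextEw (d : {fset K}) (x : N) : (msupp x `<=` d)%fset ->
  lext x = \sum_(w <- d) x@_w *: f w.
Proof.
move=> le; rewrite /lext (big_fset_incl _ le) => //= w _ /mcoeff_outdom ->.
by rewrite scale0r.
Qed.

Lemma lextU w : lext << w >> = f w.
Proof. by rewrite (lextEw msuppU_le) big_seq_fset1 mcoeffUU scale1r. Qed.

Fact lext_is_linear : linear lext.
Proof.
move=> a x y; pose d := (msupp x `|` msupp y)%fset.
have xd : (msupp x `<=` d)%fset by apply: fsubsetUl.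
have yd : (msupp y `<=` d)%fset by apply: fsubsetUr.
have axyd : (msupp (a *: x + y) `<=` d)%fset.
  apply: fsubset_trans (msuppD_le _ _) _; rewrite fsubUset yd andbT.
  exact: fsubset_trans (msuppZ_le _ _) xd.
rewrite (lextEw xd) (lextEw yd) (lextEw axyd) scaler_sumr.
rewrite -big_split /=; apply: eq_bigr => w _.
by rewrite mcoeffD mcoeffZ scalerDl scalerA.
Qed.

End LinearExtension.

Definition lext_endo (f : K -> N) : endo N := mk_endo (lext_is_linear f).

Lemma malg_span (x : N) : span (fun y => exists w, y = << w >>) x.
Proof.
rewrite (monalgE x); apply: span_sum => w _.
suff -> : << x@_w *g w >> = x@_w *: << w >>.
  by apply/spanZ/span_gen; exists w.
by apply/malgP => w'; rewrite mcoeffZ !mcoeffU mulrnAr mulr1.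
Qed.

End WordModule.

(** * Flat families *)

Section ZmodReflection.
Variable V : zmodType.

Inductive zexpr := ZVar of nat | ZZero | ZAdd of zexpr & zexpr | ZOpp of zexpr.

Fixpoint zeval (env : seq V) e : V :=
  match e with
  | ZVar i => env`_i
  | ZZero => 0
  | ZAdd e1 e2 => zeval env e1 + zeval env e2
  | ZOpp e1 => - zeval env e1
  end.

Fixpoint zcoef (i : nat) e : int :=
  match e with
  | ZVar j => (i == j)%:Z
  | ZZero => 0
  | ZAdd e1 e2 => zcoef i e1 + zcoef i e2
  | ZOpp e1 => - zcoef i e1
  end.

Lemma zevalE env e : zeval env e = \sum_(i < size env) env`_i *~ zcoef i e.
Proof.
elim: e => [j||e1 IH1 e2 IH2|e IH] /=.
- have [lt_j|le_j] := ltnP j (size env).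
    rewrite (bigD1 (Ordinal lt_j)) //= eqxx big1 ?addr0 // => i.
    by rewrite -val_eqE /= => /negbTE->.
  rewrite nth_default // big1 // => i _; case: eqP => // e.
  by move: le_j; rewrite -e leqNgt ltn_ord.
- by rewrite big1.
- by rewrite IH1 IH2 -big_split; apply: eq_bigr => i _; rewrite mulrzDr.
- by rewrite IH -sumrN; apply: eq_bigr => i _; rewrite mulrNz.
Qed.

Lemma zmod_reflection env e1 e2 :
  all (fun i => zcoef i e1 == zcoef i e2) (iota 0 (size env)) ->
  zeval env e1 = zeval env e2.
Proof.
move=> /allP e12; rewrite !zevalE; apply: eq_bigr => i _ /=.
have /e12/eqP -> // : (i : nat) \in iota 0 (size env) by rewrite mem_iota /=.
Qed.

End ZmodReflection.

(* Equality up to the instances of the ring operations. *)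
Ltac zmod_same x y :=
  match constr:((x, y)) with
  | (?a, ?a) => constr:(true)
  | ((?a * ?b)%R, (?c * ?d)%R) =>
    match zmod_same a c with true => match zmod_same b d with true =>
      constr:(true) end end
  | ((?a + ?b)%R, (?c + ?d)%R) =>
    match zmod_same a c with true => match zmod_same b d with true =>
      constr:(true) end end
  | ((- ?a)%R, (- ?c)%R) => match zmod_same a c with true => constr:(true) end
  | _ => constr:(false)
  end.

Ltac zmod_mem x l :=
  match l with
  | x :: _ => constr:(true)
  | ?y :: ?l' =>
    match zmod_same x y with true => constr:(true) | false => zmod_mem x l' end
  | _ => constr:(false)
  end.

Ltac zmod_atoms e l :=
  match e with
  | (?a + ?b)%R => let l := zmod_atoms a l in zmod_atoms b l
  | (- ?a)%R => zmod_atoms a l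
  | 0%R => l
  | _ => match zmod_mem e l with
         | true => l
         | false => constr:(e :: l)
         end
  end.

Ltac zmod_index x l :=
  match l with
  | x :: _ => constr:(0%N)
  | ?y :: ?l' =>
    match zmod_same x y with
    | true => constr:(0%N)
    | false => let i := zmod_index x l' in constr:(S i)
    end
  end.

Ltac zmod_reify e l :=
  match e with
  | (?a + ?b)%R =>
    let a' := zmod_reify a l in let b' := zmod_reify b l in constr:(ZAdd a' b')
  | (- ?a)%R => let a' := zmod_reify a l in constr:(ZOpp a')
  | 0%R => constr:(ZZero)
  | _ => let i := zmod_index e l in constr:(ZVar i)
  end.

(* Decides linear identities over an abstract abelian group. *)
Ltac zmod :=
  match goal with
  | |- @eq ?V ?a ?b =>
    let l := zmod_atoms a (@nil V) in
    let l := zmod_atoms b l in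
    let a' := zmod_reify a l in
    let b' := zmod_reify b l in
    exact: (@zmod_reflection _ l a' b' isT)
  end.

(** * Families satisfying the relations of [Qn] *)

Section Flat.
Variables (T : finType) (R : nzRingType).
Implicit Types (v : {set T} -> R) (A B C D : {set T}) (i j : T).

Definition edge v A i : R := v A - v (A :\ i).

(** This equates the coefficients of X^2 in the two products of linear factors from A down to A
    minus {i, j}; those of X agree anyway, since the edges telescope. *)
Definition flat_at v A i j :=
  edge v A i * edge v (A :\ i) j = edge v A j * edge v (A :\ j) i.

Definition flat v B := forall A i j,
  A \subset B -> i \in A -> j \in A -> i != j -> flat_at v A i j.

Lemma flatS v B C : C \subset B -> flat v B -> flat v C.
Proof. by move=> CB fB A i j sA; apply/fB/(subset_trans sA). Qed.

Lemma setD1C A i j : A :\ i :\ j = A :\ j :\ i.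
Proof. by rewrite !setDDl setUC. Qed.

Lemma flat_at_rel v A i j : flat_at v A i j <->
  v A * (v (A :\ i) - v (A :\ j)) - v (A :\ i) ^+ 2 + v (A :\ j) ^+ 2
    + (v (A :\ i) - v (A :\ j)) * v (A :\: [set i; j]) = 0.
Proof.
rewrite /flat_at /edge -setDDl (setD1C A j i) !expr2 !(mulrBl, mulrBr).
set a := v A * _; set b := v A * v _; set c := v (A :\ i) * _.
set d := v A * _; set e := v (A :\ i) * _; set f := v _ * _; set g := v _ * _.
by split=> [/eqP|/eqP]; rewrite -subr_eq0 => /eqP E;
  [rewrite -[RHS]E|apply/eqP; rewrite -subr_eq0; apply/eqP; rewrite -[RHS]E]; zmod.
Qed.

(* The three pairs of a triple {i, j, m} inside A have dependent relations
   once the relations one level below hold. *)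
Lemma flat_at_cycle v A i j m :
    flat_at v A i m -> flat_at v A j m -> flat_at v (A :\ i) j m ->
    flat_at v (A :\ j) i m -> flat_at v (A :\ m) i j ->
  flat_at v A i j.
Proof.
rewrite /flat_at /edge => /eqP + /eqP + /eqP + /eqP + /eqP.
rewrite (setD1C A m i) (setD1C A m j) (setD1C A j i) (setD1C (A :\ i) m j).
rewrite (setD1C (A :\ j) m i) (setD1C A j i).
rewrite -!(subr_eq0 _ (_ * _)) !(mulrBl, mulrBr) =>
  /eqP h1 /eqP h2 /eqP h3 /eqP h4 /eqP h5.
apply/eqP; rewrite -subr_eq0; apply/eqP.
(* The defect of the relation for (i, j) is the alternating sum of the defects of the five
   hypotheses; each 0 stands for one of them. *)
transitivity (0 - 0 + 0 - 0 + 0 : R); last by zmod.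
by rewrite -{1}h1 -{1}h2 -{1}h3 -{1}h4 -{1}h5; zmod.
Qed.
End Flat.

(** * Products of linear factors along chains of subsets *)

Section LinearFactors.
Variable R : nzRingType.
Implicit Types (a b : R) (p : {poly R}).

Definition lin a : {poly R} := 1 - a%:P * 'X.

Lemma coef_linM0 a p : (lin a * p)`_0 = p`_0.
Proof. by rewrite mulrBl mul1r coefB -mulrA -commr_polyX coefCM coefMX eqxx
  mulr0 subr0. Qed.

Lemma coef_linMS a p j : (lin a * p)`_j.+1 = p`_j.+1 - a * p`_j.
Proof. by rewrite mulrBl mul1r coefB -mulrA -commr_polyX coefCM coefMX. Qed.

Lemma size_linM a p : (size (lin a * p)%R <= (size p).+1)%N.
Proof.
apply/leq_sizeP => -[|j]; first by rewrite ltn0.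
rewrite ltnS => le_pj; rewrite coef_linMS (nth_default 0 le_pj) mulr0 subr0.
by rewrite nth_default // (leq_trans le_pj).
Qed.

Lemma linM a b : lin a * lin b = 1 - (a + b)%:P * 'X + (a * b)%:P * 'X^2.
Proof.
rewrite /lin mulrBl mul1r !mulrBr mulr1 polyCD polyCM mulrDl.
have -> : a%:P * 'X * (b%:P * 'X) = a%:P * b%:P * 'X^2.
  by rewrite -!mulrA; congr (_ * _); rewrite mulrA -commr_polyX -mulrA -expr2.
zmod.
Qed.

End LinearFactors.

Section Chain.
Variables (T : finType) (R : nzRingType).
Implicit Types (v : {set T} -> R) (A B C D : {set T}) (i j : T).

Fixpoint chain_rec v m D B : {poly R} :=
  if m is m'.+1 then
    if [pick i in B :\: D] is Some i then
      lin (edge v B i) * chain_rec v m' D (B :\ i)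
    else 1
  else 1.

(* The product of the factors 1 - (v_C - v_{C \ i}) X along a maximal chain
   from B down to D; it does not depend on the chain when v is flat. *)
Definition chain v D B := chain_rec v #|B :\: D| D B.

Lemma chain_id v B : chain v B B = 1.
Proof. by rewrite /chain setDv cards0. Qed.

Lemma cardsDD1 B D i : i \in B :\: D -> #|B :\: D| = #|(B :\ i) :\: D|.+1.
Proof. by move=> iBD; rewrite (cardsD1 i) iBD setDDl setUC -setDDl. Qed.

Lemma chain_pick v D B : B :\: D != set0 ->
  exists2 j, j \in B :\: D &
    chain v D B = lin (edge v B j) * chain v D (B :\ j).
Proof.
move=> BD0; rewrite {1}/chain; case e: #|B :\: D| => [|m] /=.
  by move: BD0; rewrite (cards0_eq e) eqxx.
case: pickP => [j jBD|BD]; last first.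
  by case/set0Pn: BD0 => i; rewrite BD.
by exists j => //; move: e; rewrite (cardsDD1 jBD) => -[<-].
Qed.

(** Any element may be removed first. If the chain picked j instead, induction brings i to second
    place, and flatness swaps the two leading quadratic products. *)
Lemma chainD1 v D B i : flat v B -> D \subset B -> i \in B :\: D ->
  chain v D B = lin (edge v B i) * chain v D (B :\ i).
Proof.
have [m] := ubnP #|B :\: D|; elim: m => // m IH in D B i *.
rewrite ltnS => ltBD fB DB iBD.
have BD0 : B :\: D != set0 by apply/set0Pn; exists i.
have [j jBD ->] := chain_pick v BD0.
have [-> //|ij] := eqVneq j i.
have iB : i \in B by case/setDP: iBD.
have jB : j \in B by case/setDP: jBD.
have D1 l : l \in B :\: D -> D \subset B :\ l.
  by case/setDP=> _ lD; rewrite subsetD1 DB.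
have flatD1 l : flat v (B :\ l) := flatS (subD1set B l) fB.
have iBjD : i \in (B :\ j) :\: D by move: iBD; rewrite !inE eq_sym ij.
have jBiD : j \in (B :\ i) :\: D by move: jBD; rewrite !inE ij.
rewrite (IH D (B :\ j) i) ?D1 //; last by rewrite (cardsDD1 jBD) in ltBD.
rewrite (IH D (B :\ i) j) ?D1 //; last by rewrite (cardsDD1 iBD) in ltBD.
rewrite !mulrA (setD1C B j i) !linM (fB B i j) // 1?eq_sym //.
congr ((1 - _ * 'X + _) * _); congr (_%:P); rewrite /edge (setD1C B j i); zmod.
Qed.

(** By [chainD1] the chain from B to C can be routed through D. *)
Lemma chain_trans v C D B : flat v B -> C \subset D -> D \subset B ->
  chain v C B = chain v D B * chain v C D.
Proof.
have [m] := ubnP #|B :\: D|; elim: m => // m IH in B *.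
rewrite ltnS => ltBD fB CD DB.
have [BD0|/set0Pn[i iBD]] := eqVneq (B :\: D) set0.
  have -> : B = D by apply/eqP; rewrite eqEsubset DB -setD_eq0 BD0 eqxx.
  by rewrite chain_id mul1r.
have iBC : i \in B :\: C.
  by case/setDP: iBD => iB iD; rewrite inE iB andbT (contraNN (subsetP CD i)).
rewrite (chainD1 fB (subset_trans CD DB) iBC) (chainD1 fB DB iBD) -mulrA.
rewrite -IH //; first by rewrite (cardsDD1 iBD) in ltBD.
  exact: flatS (subD1set B i) fB.
by rewrite subsetD1 DB; case/setDP: iBD.
Qed.

Lemma size_chain v D B : (size (chain v D B) <= #|B :\: D|.+1)%N.
Proof.
rewrite /chain; move: #|B :\: D| => m; elim: m B => [|m IH] B /=;
  first by rewrite size_poly1.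
case: pickP => [i _|_]; last by rewrite size_poly1.
by apply: leq_trans (size_linM _ _) _; rewrite ltnS.
Qed.

Lemma coef0_chain v D B : (chain v D B)`_0 = 1.
Proof.
rewrite /chain; move: #|B :\: D| => m; elim: m B => [|m IH] B /=;
  first by rewrite coef1.
by case: pickP => [i _|_]; rewrite ?coef1 // coef_linM0.
Qed.

Lemma coef1_chain v D B : D \subset B -> (chain v D B)`_1 = v D - v B.
Proof.
have [m] := ubnP #|B :\: D|; elim: m => // m IH in B *.
rewrite ltnS => ltBD DB.
have [BD0|BD0] := eqVneq (B :\: D) set0.
  have -> : B = D by apply/eqP; rewrite eqEsubset DB -setD_eq0 BD0 eqxx.
  by rewrite chain_id coef1 subrr.
have [i iBD ->] := chain_pick v BD0.
rewrite coef_linMS coef0_chain mulr1 IH ?/edge; first by zmod.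
  by rewrite (cardsDD1 iBD) in ltBD.
by rewrite subsetD1 DB; case/setDP: iBD.
Qed.

End Chain.

(** The image of the picked chain need not be the chain picked for [w]; flatness of [w] makes the
    products agree. *)
Lemma map_chain (T : finType) (R S : nzRingType) (f : {rmorphism R -> S})
    (p : {perm T}) (v : {set T} -> R) (w : {set T} -> S) (D B : {set T}) :
    (forall A, f (v A) = w (p @: A)) -> flat w (p @: B) -> D \subset B ->
  map_poly f (chain v D B) = chain w (p @: D) (p @: B).
Proof.
move=> fv; have [m] := ubnP #|B :\: D|; elim: m => // m IH in B *.
have pD A i : p @: (A :\ i) = (p @: A) :\ p i.
  apply/setP => l; rewrite -[l](permKV p) !inE.
  by rewrite !(mem_imset _ _ (@perm_inj _ p)) !inE (inj_eq perm_inj).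
rewrite ltnS => ltBD fl DB.
have [BD0|BD0] := eqVneq (B :\: D) set0.
  have -> : B = D by apply/eqP; rewrite eqEsubset DB -setD_eq0 BD0 eqxx.
  by rewrite !chain_id rmorph1.
have [i iBD ->] := chain_pick v BD0.
have [iB iD] := setDP iBD.
rewrite rmorphM /= IH; first last.
- by rewrite subsetD1 DB.
- by apply: flatS fl; rewrite pD subD1set.
- by rewrite (cardsDD1 iBD) in ltBD.
rewrite (chainD1 (i := p i) fl) ?imsetS //.
  rewrite pD /lin rmorphB rmorph1 rmorphM /= map_polyC map_polyX /edge.
  by congr ((1 - _%:P * _) * _); rewrite [LHS]rmorphB !fv pD.
by rewrite !inE !(mem_imset _ _ (@perm_inj _ p)) iB iD.
Qed.

(** * Linear independence *)

Section NormalWords.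
Variables (L : eqType) (fits : L -> seq L -> bool).

(** [fits] sees the whole remaining word, because a forbidden pattern may be longer than two
    letters. *)
Fixpoint normal (w : seq L) : bool :=
  if w is l :: w' then fits l w' && normal w' else true.

Lemma normal_cat w1 w2 : normal (w1 ++ w2) -> normal w2.
Proof. by elim: w1 => //= l w IH /andP[_ /IH]. Qed.

Lemma normal_cons l w : normal (l :: w) = fits l w && normal w.
Proof. by []. Qed.

End NormalWords.

Arguments normal : simpl never.

Section Letters.
Variable n : nat.

Definition xletter : Type := ('I_n * {set 'I_n})%type.
HB.instance Definition _ := Finite.on xletter.

Definition below (m : nat) : {set 'I_n} := [set i : 'I_n | (i < m)%N].

(* The letter (m, B) stands for v_{m |: B} - v_B, where B lies below m; the
   words to avoid are (m, B) (m, D)^r with D \proper B and r = #|B :\: D|. *)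
Definition xfits (l : xletter) (w : seq xletter) : bool :=
  if w is l' :: _ then
    ~~ [&& l'.1 == l.1, l'.2 \proper l.2 & prefix (nseq #|l.2 :\: l'.2| l') w]
  else true.

Definition starts_below m (w : seq xletter) : bool :=
  if w is l :: _ then (l.1 < m)%N else true.

End Letters.

(* W has basis wd; it is kept abstract because unification gets lost when it
   can unfold {malg k[_]}. *)
Section WordAction.
Variables (k : fieldType) (n : nat) (W : lmodType k).
Variables (wd : seq (xletter n) -> W) (ext : (seq (xletter n) -> W) -> endo W).
Hypothesis extU : forall f w, ext f (wd w) = f w.
Hypothesis wd_span : forall x, span (fun y => exists w, y = wd w) x.
Hypothesis wd_nil : wd [::] != 0.

Local Notation E := (nz_endo wd_nil).
Local Notation xnormal := (normal (@xfits n)).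
Local Notation below := (below n).
Implicit Types (B C D A : {set 'I_n}) (w : seq (xletter n)) (x : W).

(** On these vectors every letter of level at least m acts by plain prepending: no forbidden pattern
    mixes levels. *)
Definition low m : W -> Prop := span (fun y =>
  exists w, [/\ y = wd w, xnormal w & starts_below m w]).

Lemma lowS m m' x : (m <= m')%N -> low m x -> low m' x.
Proof.
move=> le_m; apply: span_sub => _ [w [-> nw sw]]; apply: span_gen; exists w.
by split=> //; case: w sw {nw} => //= l w sw; apply: leq_trans le_m.
Qed.

(** The telescoping sum that recovers v_A from the differences x(m, B), adding the elements of A in
    increasing order. *)
Definition vop (Y : 'I_n -> {set 'I_n} -> E) A : E :=
  \sum_(m in A) Y m (A :&: below m).

(** The invariant of the induction on levels. All words form a basis of [W], but only the normal
    ones carry the action; the others are sent to 0. *)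
Definition is_action M Y : Prop :=
  [/\ flat (vop Y) (below M),
      forall (m : 'I_n) B w, (m < M)%N -> B \subset below m ->
        xnormal ((m, B) :: w) -> Y m B (wd w) = wd ((m, B) :: w),
      forall (m : 'I_n) B x, (m < M)%N -> B \subset below m -> low m.+1 (Y m B x)
    & forall (m : 'I_n) B w, (m < M)%N -> B \subset below m ->
        ~~ xnormal w -> Y m B (wd w) = 0].

Lemma xfits_low (M : 'I_n) B w : starts_below M w -> xfits (M, B) w.
Proof.
by case: w => //= -[m D] w /= lt_m; rewrite -val_eqE ltn_eqF.
Qed.

Definition xcons (M : 'I_n) B : E :=
  ext (fun w => wd ((M, B) :: w)).

Lemma xconsU (M : 'I_n) B w : xcons M B (wd w) = wd ((M, B) :: w).
Proof. exact: extU. Qed.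

(** * Extending the action to the letters of level [M] *)

Section Level.
Variables (M : 'I_n) (Y : 'I_n -> {set 'I_n} -> E).
Hypothesis YP : is_action M Y.
Local Notation V := (vop Y).
Local Notation q D B := (chain (V : {set 'I_n} -> E) D B).
Local Notation S D w' i := (nseq i (M, D) ++ w' : seq (xletter n)).

(** The terms of positive degree in the chain product, applied to decreasing powers of the letter
    (M, D); the term of degree 0 is kept apart. *)
Definition tailsum B D r (s : nat -> W) : W :=
  \sum_(j < r) (q D B)`_j.+1 (s (r - j)%N).

(* The value on a word that must be avoided is read off the vanishing of the
   coefficient of X^(r+1) in chain (m |: D) (m |: B), for r = #|B :\: D|. *)
Definition level_word B w : W :=
  if ~~ xnormal w then 0
  else if xfits (M, B) w then (wd ((M, B) :: w))
  else if w is l :: _ then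
    let r := #|B :\: l.2| in let s j := (wd (S l.2 (drop r w) j)) in
    s r.+1 + tailsum B l.2 r s - xcons M B (tailsum B l.2 r (fun j => s j.-1))
  else 0.

Definition level B : E := ext (level_word B).

Lemma levelU B w : level B (wd w) = level_word B w.
Proof. exact: extU. Qed.

Lemma level_nonnormal B w : ~~ xnormal w -> level B (wd w) = 0.
Proof. by move=> nw; rewrite levelU /level_word nw. Qed.

Lemma level_normal B w : xnormal ((M, B) :: w) -> level B (wd w) = wd ((M, B) :: w).
Proof. by rewrite normal_cons => /andP[fw nw];
  rewrite levelU /level_word nw fw. Qed.

(** Lengthening a block of equal letters creates no forbidden pattern, since D is not proper in
    itself. The hypothesis needs a nonempty block, so that (M, D) is known to fit [w]. *)
Lemma xnormal_power D w i j : xnormal (S D w i.+1) -> xnormal (S D w j).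
Proof.
move=> nSi; elim: j => [|j IH]; first exact: (@normal_cat _ _ (nseq i.+1 (M, D))).
change (xnormal ((M, D) :: S D w j)); rewrite normal_cons IH andbT.
case: j IH => [|j] _ /=; last by rewrite properxx andbF.
have : xnormal (nseq i (M, D) ++ S D w 1).
  by rewrite catA -nseqD addn1.
by move/normal_cat; rewrite normal_cons => /andP[].
Qed.

Lemma level_avoided B D w r : D \proper B -> #|B :\: D| = r -> xnormal (S D w r) ->
  let s j := (wd (S D w j)) : W in
  level B (wd (S D w r)) =
    s r.+1 + tailsum B D r s - xcons M B (tailsum B D r (fun j => s j.-1)).
Proof.
move=> DB rE nS s; rewrite levelU /level_word nS.
have : (0 < r)%N by rewrite -rE card_gt0 setD_eq0;
  case/properP: DB => _ [i iB iD]; apply/subsetPn; exists i.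
case: r rE nS @s => // r rE nS s _.
have -> : xfits (M, B) (S D w r.+1) = false.
  by rewrite /xfits /= eqxx DB rE /= eqxx prefix_prefix.
rewrite /= rE; set d := drop _ _.
by have -> : d = w by rewrite /d -[RHS](@drop_size_cat _ r.+1 (nseq r.+1 (M,
  D))) ?size_nseq.
Qed.

Lemma xfitsPn B w : ~~ xfits (M, B) w ->
  exists D w', D \proper B /\ w = S D w' #|B :\: D|.
Proof.
case: w => // -[m D] w; rewrite /xfits negbK => /and3P[/eqP mM DB /prefixP[w' e]].
by exists D, w'; split; rewrite // -[M]mM.
Qed.

Lemma level_low B x : low M x -> level B x = xcons M B x.
Proof.
apply: endo_eq_span => _ [w [-> nw sw]].
by rewrite xconsU level_normal // normal_cons nw xfits_low.
Qed.

Lemma vop_low A x : A \subset below M -> low M (V A x).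
Proof.
move=> sA; rewrite endo_sumE; apply: span_sum => m /(subsetP sA).
rewrite inE => lt_m; apply: (lowS lt_m).
by case: YP => _ _ Ylow _; apply: Ylow => //; apply: subsetIr.
Qed.

(** In every term of positive degree the operator applied last is an edge below M, whose values are
    low. Hence [level_word] can use [xcons] on tails, without calling itself. *)
Lemma chain_low B D j x : B \subset below M -> low M ((q D B)`_j.+1 x).
Proof.
move=> sB; have [m] := ubnP #|B :\: D|; elim: m => // m IH in B j sB *.
rewrite ltnS => ltBD; have [BD0|BD0] := eqVneq (B :\: D) set0.
  by rewrite /chain BD0 cards0 /= coef1 endo0E; apply: span0.
have [i iBD ->] := chain_pick (V : {set 'I_n} -> E) BD0.
have sB' : B :\ i \subset below M by apply: subset_trans sB; apply: subD1set.
rewrite coef_linMS endoBE endoME; apply: spanB.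
  by apply: IH => //; rewrite (cardsDD1 iBD) in ltBD.
by rewrite /edge endoBE; apply: spanB; apply: vop_low.
Qed.

Lemma vop_nonnormal A w : A \subset below M -> ~~ xnormal w -> V A (wd w) = 0.
Proof.
move=> sA nw; rewrite endo_sumE big1 // => m /(subsetP sA); rewrite inE => lt_m.
by case: YP => _ _ _ Y0; apply: Y0 => //; apply: subsetIr.
Qed.

Lemma tailsum_low B D r s : B \subset below M -> low M (tailsum B D r s).
Proof. by move=> sB; apply: span_sum => j _; apply: chain_low. Qed.

Lemma low_xcons B x : low M x -> low M.+1 (xcons M B x).
Proof.
apply: span_lin => [|_ [w [-> nw sw]]]; first exact: endoP.
rewrite xconsU; apply: span_gen; exists ((M, B) :: w); split=> //;
  last exact: leqnn.
by rewrite normal_cons nw xfits_low.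
Qed.

Lemma low_level B x : B \subset below M -> low M.+1 (level B x).
Proof.
move=> sB; elim: (wd_span x) => [|c _ y [w ->] _ IH];
  first by rewrite endo_fun0; apply: span0.
rewrite endo_lin; apply: spanD => //; apply: spanZ.
have [nw|nw] := boolP (xnormal w); last first.
  by rewrite level_nonnormal //; apply: span0.
have [fw|/xfitsPn[D [w' [DB wE]]]] := boolP (xfits (M, B) w).
  rewrite level_normal ?normal_cons ?fw //; apply: span_gen.
  by exists ((M, B) :: w); split; [|rewrite normal_cons fw|exact: leqnn].
rewrite wE in nw *; rewrite level_avoided //; apply: spanB; last first.
  exact/low_xcons/tailsum_low.
apply: spanD; last by apply: (lowS (leqnSn M)); apply: tailsum_low.
apply: span_gen; exists (S D w' #|B :\: D|.+1); split; [by [] | | exact: leqnn].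
have : (0 < #|B :\: D|)%N.
  by rewrite card_gt0 setD_eq0; case/properP: DB => _ [i iB iD];
    apply/subsetPn; exists i.
by case: #|_| nw => // r nw _; apply: (@xnormal_power _ _ r r.+2 nw).
Qed.

Section Relation.
Variables (B : {set 'I_n}) (i : 'I_n) (e : E).
Hypotheses (sB : B \subset below M) (iB : i \in B) (eE : e = edge V B i).
Local Notation C := (B :\ i).

Let sC : C \subset below M. Proof. exact: subset_trans (subD1set B i) sB. Qed.

Let e_low x : low M (e x).
Proof. by rewrite eE /edge endoBE; apply: spanB; apply: vop_low. Qed.

Let flatB : flat (V : {set 'I_n} -> E) B.
Proof. by case: YP => fV _ _ _; apply: flatS fV. Qed.

(** The shortest forbidden pattern, (M, B) (M, C) with one element removed; the chain product is
    then the single factor [lin e]. *)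
Lemma relation_normal w : xnormal ((M, C) :: w) ->
  level B (wd ((M, C) :: w)) =
    (wd ((M, C) :: (M, C) :: w)) - e (wd ((M, C) :: w)) + xcons M B (e (wd w)).
Proof.
move=> nCw; have CB : C \proper B by apply: properD1.
have BC : #|B :\: C| = 1%N.
  by rewrite setDDr setDv set0U (setIidPr _) ?cards1 // sub1set.
have iBC : i \in B :\: C by rewrite !inE eqxx iB.
have := @level_avoided B C w 1 CB BC nCw.
rewrite /= => ->; rewrite /tailsum !big_ord_recl !big_ord0 !addr0 /=.
rewrite (chainD1 flatB _ iBC) ?subD1set // chain_id -eE.
have -> : (lin e * 1)`_1 = - e by rewrite coef_linMS !coef1 mulr1 sub0r.
by rewrite !endoNE endo_funN opprK.
Qed.

Lemma relation_low x : low M x ->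
  level B (xcons M C x) =
    xcons M C (xcons M C x) - e (xcons M C x) + xcons M B (e x).
Proof.
apply: (@endo_eq_span _ _ _ (level B * xcons M C : E)
  (xcons M C * xcons M C - e * xcons M C + xcons M B * e)) => _ [w [-> nw sw]].
rewrite endoDE endoBE !endoME !xconsU relation_normal //.
by rewrite normal_cons nw xfits_low.
Qed.

(** Both sides are expanded by the rule for forbidden words. The factorization
    [q D B = lin e * q D C] expresses the tails for B through those for C, and the terms cancel. *)
Lemma relation_avoided D w r : D \proper C -> #|C :\: D| = r ->
    xnormal (S D w r) ->
  level B (level C (wd (S D w r))) = level B (e (wd (S D w r)))
    + level C (level C (wd (S D w r))) - e (level C (wd (S D w r))).
Proof.
move=> DC rE nS; pose s j : W := wd (S D w j).
have DB : D \proper B by apply: proper_sub_trans DC (subD1set B i).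
have iBD : i \in B :\: D.
  by rewrite inE iB andbT; apply: contraTN (proper_sub DC) => iD;
    apply/subsetPn; exists i; rewrite // !inE eqxx.
have rE' : #|B :\: D| = r.+1 by rewrite (cardsDD1 iBD) rE.
have r0 : (0 < r)%N.
  by rewrite -rE card_gt0 setD_eq0; case/properP: DC => _ [l lC lD];
    apply/subsetPn; exists l.
have nSj j : xnormal (S D w j) by case: (r) r0 nS => // r' _ /xnormal_power; apply.
pose a := tailsum C D r s; pose b := tailsum C D r (fun j => s j.-1).
pose c := tailsum C D r (fun j => s j.+1).
have E1 : level C (s r) = s r.+1 + a - xcons M C b by apply: level_avoided.
(* Moving one letter of the block into the tail lets the rule for exponent r be used at exponent r +
   1. *)
have SS j : S D ((M, D) :: w) j = S D w j.+1.
  by elim: j => //= j ->.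
have E2 : level C (s r.+1) = s r.+2 + c - xcons M C a.
  rewrite /s -SS level_avoided ?SS //; congr (_ + _ - _).
    by apply: eq_bigr => j _; rewrite SS.
  by congr (xcons _ _ _); apply: eq_bigr => j _; rewrite SS prednK // subn_gt0.
have qE : q D B = lin e * q D C by rewrite eE; apply: chainD1 => //;
  apply: proper_sub.
(* The degree of [q D C] is at most r, so the longer tail for B gains no term from this
   coefficient. *)
have q_top : (q D C)`_r.+1 = 0 :> E.
  by rewrite nth_default // (leq_trans (size_chain _ _ _)) // rE.
have E3 : level B (s r.+1) = s r.+2 + c - e (s r.+1) - e a - xcons M B a
    + xcons M B (e (s r)) + xcons M B (e b).
  (* Each coefficient for B is the one for C minus [e] times the preceding one; the constant
     coefficient 1 yields the isolated term [e (t r.+1)]. *)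
  have split_tail (t : nat -> W) : tailsum B D r.+1 t =
      tailsum C D r (fun j => t j.+1) - e (t r.+1) - e (tailsum C D r t).
    rewrite /tailsum qE.
    under eq_bigr => j _ do rewrite coef_linMS endoBE endoME.
    rewrite sumrB big_ord_recr q_top /= endo0E addr0 -addrA -opprD; congr (_ - _).
      by apply: eq_bigr => j _; rewrite subSn // ltnW.
    by rewrite -endo_fun_sum big_ord_recl coef0_chain endo1E subn0 endo_funD.
  rewrite /s level_avoided // !split_tail /= -/(s _) -/a -/b -/c.
  by rewrite !endo_funB; zmod.
have aL : low M a by apply: tailsum_low.
have bL : low M b by apply: tailsum_low.
have cons_cons : level C (xcons M C b) = xcons M C (xcons M C b).
  move: bL; apply: (@endo_eq_span _ _ _ (level C * xcons M C : E)
    (xcons M C * xcons M C)) => _ [u [-> nu su]].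
  rewrite !endoME !xconsU level_normal //.
  by rewrite !normal_cons (xfits_low _ su) nu /= properxx andbF.
rewrite -/(s r) E1 !endo_funB !endo_funD /= E2 E3 relation_low // cons_cons.
by rewrite (level_low _ (e_low _)) !(level_low _ aL); zmod.
Qed.

(** The relation for the pair (i, M) in [M |: B], solved for x(M, B) x(M, C). It is checked on
    words: non-normal ones, those that (M, C) fits, and those starting with a block forbidden after
    (M, C). *)
Lemma level_relation :
  level B * level C = level B * e + level C * level C - e * level C :> E.
Proof.
apply: endo_ext => x; apply: endo_eq_span (wd_span x) => _ [w ->].
rewrite endoBE endoDE !endoME.
have [nw|nw] := boolP (xnormal w); last first.
  have ew : e (wd w) = 0 by rewrite eE /edge endoBE !vop_nonnormal // subrr.
  by rewrite ew !level_nonnormal // !endo_fun0 addr0 subrr.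
have [fw|/xfitsPn[D [w' [DB wE]]]] := boolP (xfits (M, C) w); last first.
  by rewrite wE in nw *; apply: relation_avoided.
have nCw : xnormal ((M, C) :: w) by rewrite normal_cons fw.
rewrite (level_normal nCw) relation_normal // level_normal; last first.
  by rewrite !normal_cons fw nw /= properxx andbF.
by rewrite (level_low _ (e_low _)); zmod.
Qed.

End Relation.
End Level.
End WordAction.

(** * Universal property of [Qn] *)

Section Universal.
Variables (k : fieldType) (n : nat) (A : algType k) (v : {set 'I_n} -> A).
Hypotheses (v0 : v set0 = 0) (v_flat : flat v setT).
Local Notation Q := (Qn k n).

Definition gen_lift : freeAlg k (Qgen n) -> A :=
  free_lift (fun g : Qgen n => v (val g)).

HB.instance Definition _ := GRing.LRMorphism.on gen_lift.

Local Notation F := gen_lift.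

Fact gen_lift_v B : F (Qfree_v k B) = v B.
Proof.
rewrite /Qfree_v; case: insubP => [g _ <-|]; first exact: free_lift_gen.
by rewrite negbK => /eqP->; rewrite v0 raddf0.
Qed.

Fact gen_lift_rel x : Qrel x -> F x = 0.
Proof.
case=> B i j _ iB jB ij; rewrite rmorph_relator /= !gen_lift_v.
by apply/flat_at_rel/v_flat; rewrite ?subsetT.
Qed.

Lemma Qn_universal : exists g : Q -> A,
  [/\ linear g, g 1 = 1, {morph g : x y / x * y} & forall B, g (Qv k B) = v B].
Proof.
pose g : Q -> A := quot_lift gen_lift.
have gE x : g (quot_pi (@Qrel k n) x) = gen_lift x := quot_liftE gen_lift_rel x.
exists g; split=> [a||| B].
- elim/quot_ind=> x; elim/quot_ind=> y.
  have e : a *: quot_pi _ x + quot_pi _ y = quot_pi (@Qrel k n) (a *: x + y).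
    exact: esym (quot_pi_is_linear (@Qrel k n) a x y).
  transitivity (F (a *: x + y)); first by rewrite -gE -e.
  by rewrite (gE x) (gE y); exact: (linearP F a x y).
- by rewrite [LHS](gE 1) rmorph1.
- elim/quot_ind=> x; elim/quot_ind=> y.
  by rewrite -rmorphM !gE rmorphM.
- exact: etrans (gE _) (gen_lift_v B).
Qed.

End Universal.

Lemma Qv_flat (k : fieldType) (n : nat) (B : {set 'I_n}) : flat (@Qv k n) B.
Proof.
move=> A i j _ iA jA ij; apply/flat_at_rel/Qv_rel => //.
by rewrite (cardsD1 i) iA (cardsD1 j) !inE eq_sym ij jA.
Qed.

(** With a, b the letters (M, B), (M, B minus i) and c, d the values at B, B minus i, this turns
    [level_relation] into flatness. *)
Lemma relation_flat (R : nzRingType) (a b c d : R) :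
    a * b = a * (c - d) + b * b - (c - d) * b ->
  (a + c - (b + d)) * b = a * (c - d).
Proof. by move=> ab; rewrite mulrBl !mulrDl ab mulrBl; zmod. Qed.

(** * The action of [Qn] on words, and independence *)

Section ExistsAction.
Variables (k : fieldType) (n : nat) (W : lmodType k).
Variables (wd : seq (xletter n) -> W) (ext : (seq (xletter n) -> W) -> endo W).
Hypothesis extU : forall f w, ext f (wd w) = f w.
Hypothesis wd_span : forall x, span (fun y => exists w, y = wd w) x.
Hypothesis wd_nil : wd [::] != 0.

Local Notation E := (nz_endo wd_nil).
Local Notation xnormal := (normal (@xfits n)).
Local Notation is_action := (@is_action k n W wd wd_nil).
Implicit Types (A B : {set 'I_n}) (Y : 'I_n -> {set 'I_n} -> E).

Lemma belowS (M : 'I_n) A : A \subset below n M.+1 -> A :\ M \subset below n M.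
Proof.
move/subsetP=> sA; apply/subsetP => i; rewrite !inE => /andP[iM /sA].
by rewrite inE ltnS leq_eqVlt val_eqE (negbTE iM).
Qed.

Lemma vop_add Y (m : 'I_n) B : B \subset below n m ->
  vop Y (m |: B) = Y m B + vop Y B.
Proof.
move=> /subsetP sB; have mB : m \notin B by apply/negP => /sB; rewrite inE ltnn.
rewrite /vop big_setU1 //=; congr (Y m _ + _).
  apply/setP => i; rewrite !inE; have [->|im] /= := eqVneq.
    by rewrite ltnn (negbTE mB).
  by apply/andb_idr => /sB; rewrite inE.
apply: eq_bigr => j jB; congr (Y j _); apply/setP => i; rewrite !inE.
have [->|//] := eqVneq i m; have := sB _ jB; rewrite inE => lt_jm.
by rewrite ltnNge ltnW ?andbF.
Qed.

Lemma flat_at_ext (v v' : {set 'I_n} -> E) A i j :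
  (forall B, B \subset A -> v B = v' B) -> flat_at v A i j -> flat_at v' A i j.
Proof.
move=> vv'; rewrite /flat_at /edge !vv' //;
  by do ?apply: subset_trans (subD1set _ _) _.
Qed.

(** Relations for sets without M are inherited, those for pairs containing M come from
    [level_relation], and the rest follow from these two kinds. *)
Lemma is_action_step (M : 'I_n) Y : is_action M Y ->
  exists Y', is_action M.+1 Y'.
Proof.
move=> YP; pose lev : {set 'I_n} -> E := level ext M Y.
pose Y' (m : 'I_n) B : E := if m == M then lev B else Y m B.
have oldY (m : 'I_n) B : (m < M)%N -> Y' m B = Y m B.
  by move=> lt_m; rewrite /Y' -val_eqE ltn_eqF.
have oldV A : A \subset below n M -> vop Y A = vop Y' A.
  move=> /subsetP sA; apply: eq_bigr => m /sA; rewrite inE => lt_m.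
  by rewrite oldY.
have newV A : A \subset below n M.+1 -> M \in A ->
    vop Y' A = lev (A :\ M) + vop Y (A :\ M).
  move=> sA MA; rewrite -{1}(setD1K MA) vop_add ?belowS // {1}/Y' eqxx.
  by rewrite oldV ?belowS.
have fV : flat (vop Y) (below n M) by case: YP.
have flatM A i : A \subset below n M.+1 -> M \in A -> i \in A -> i != M ->
    flat_at (vop Y') A i M.
  move=> sA MA iA iM; pose B := A :\ M.
  have sB : B \subset below n M := belowS sA.
  have iB : i \in B by rewrite !inE iM.
  have sA' : A :\ i \subset below n M.+1 := subset_trans (subD1set A i) sA.
  have MA' : M \in A :\ i by rewrite !inE eq_sym iM.
  have AiM : A :\ i :\ M = B :\ i by rewrite setD1C.
  rewrite /flat_at /edge (newV A) // (newV (A :\ i)) // !AiM -/B -!oldV //;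
    last first.
    exact: subset_trans (subD1set B i) sB.
  rewrite !addrK.
  have R : lev B * lev (B :\ i) = lev B * edge (vop Y) B i +
      lev (B :\ i) * lev (B :\ i) - edge (vop Y) B i * lev (B :\ i).
    exact: (level_relation extU wd_span YP sB iB erefl).
  exact: (relation_flat R).
exists Y'; split.
- move=> A i j sA iA jA ij.
  have [MA|MA] := boolP (M \in A); last first.
    have sA' : A \subset below n M.
      by apply: subset_trans (belowS sA); rewrite subsetD1 subxx.
    apply: (@flat_at_ext (vop Y)); last exact: fV.
    by move=> B sB; apply/oldV/(subset_trans sB).
  have sAD l : A :\ l \subset below n M.+1 := subset_trans (subD1set A l) sA.
  have [iM|iM] := eqVneq i M.
    by apply/esym; rewrite iM in ij *; apply: flatM; rewrite // eq_sym.
  have [jM|jM] := eqVneq j M; first by rewrite jM in jA ij *; apply: flatM.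
  (* For i and j other than M, the triple {i, j, M} reduces the relation to pairs containing M and
     to one relation in [A :\ M]. *)
  apply: (@flat_at_cycle _ _ _ _ _ _ M); try by apply: flatM;
    rewrite // !inE ?(eq_sym M) ?iM ?jM // eq_sym ij.
    by apply: flatM => //; rewrite !inE ?(eq_sym M) ?jM ?ij.
  apply: (@flat_at_ext (vop Y)).
    by move=> B sB; apply/oldV/(subset_trans sB)/belowS.
  by apply: fV; rewrite ?belowS // !inE ?iM ?jM.
- move=> m B w; rewrite ltnS leq_eqVlt => /predU1P[/val_inj->|lt_m] sB nw.
    by rewrite /Y' eqxx; apply: level_normal.
  by rewrite oldY //; case: YP => _ + _ _; apply.
- move=> m B x; rewrite ltnS leq_eqVlt => /predU1P[/val_inj->|lt_m] sB.
    by rewrite /Y' eqxx; apply: low_level.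
  by rewrite oldY //; case: YP => _ _ + _; apply.
- move=> m B w; rewrite ltnS leq_eqVlt => /predU1P[/val_inj->|lt_m] sB nw.
    by rewrite /Y' eqxx; apply: level_nonnormal.
  by rewrite oldY //; case: YP => _ _ _ +; apply.
Qed.

Lemma is_action_exists : exists Y, is_action n Y.
Proof.
suff: forall m, (m <= n)%N -> exists Y, is_action m Y by apply.
elim=> [|m IH] le_mn.
  exists (fun _ _ => 0); split=> // A i j sA iA.
  by have := subsetP sA _ iA; rewrite inE.
have [Y YP] := IH (ltnW le_mn).
exact: (@is_action_step (Ordinal le_mn) Y).
Qed.

Definition xvalid (l : xletter n) : bool := l.2 \subset below n l.1.

Definition xval (l : xletter n) : Qn k n := Qv k (l.1 |: l.2) - Qv k l.2.

(** The map applies an element of [Qn] to the empty word; reading a normal word from the right, each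
    letter is simply prepended. *)
Lemma xword_map : exists g : Qn k n -> W, linear g /\
  forall w, xnormal w -> all xvalid w -> g (\prod_(l <- w) xval l) = wd w.
Proof.
have [Y YP] := is_action_exists; have [fY Yw _ _] := YP.
have V0 : vop Y set0 = 0 by rewrite /vop big_set0.
have Vflat : flat (vop Y) [set: 'I_n].
  by apply: flatS fY; apply/subsetP => i _; rewrite inE.
have [g [g_lin g1 gM gV]] := Qn_universal V0 Vflat.
exists (fun x => g x (wd [::])); split=> [a x y|].
  by rewrite g_lin endoDE endoZE.
elim=> [|[m B] w IH]; first by rewrite big_nil g1.
rewrite normal_cons => /andP[fw nw] /= /andP[sB vw].
rewrite big_cons gM endoME IH //= /xval /=.
have -> : g (Qv k (m |: B) - Qv k B) = Y m B.
  by rewrite -scaleN1r addrC g_lin !gV scaleN1r vop_add // addrC addrK.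
by apply: Yw; rewrite // normal_cons fw.
Qed.

End ExistsAction.

Lemma xword_free (k : fieldType) (n m : nat) (ws : 'I_m -> seq (xletter n))
    (c : 'I_m -> k) :
    injective ws -> (forall i, normal (@xfits n) (ws i)) ->
    (forall i, all (@xvalid n) (ws i)) ->
    \sum_i c i *: \prod_(l <- ws i) xval k l = 0 -> forall i, c i = 0.
Proof.
move=> ws_inj nws vws c0 i.
(* The abstract module becomes the free module on all words, where coefficients can be read off. *)
pose wd (w : seq (xletter n)) : {malg k[seq (xletter n)]} := << w >>.
have wd_nil : wd [::] != 0 by rewrite monalgU_eq0 oner_eq0.
have [g [g_lin gw]] := @xword_map k n _ wd (@lext_endo k _)
  (@lextU k _ _) (@malg_span k _) wd_nil.
have g0 : g 0 = 0.
  by have := g_lin (-1) 0 0; rewrite scaler0 addr0 => ->; rewrite scaleN1r addNr.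
have gsum (r : seq 'I_m) : g (\sum_(i <- r) c i *: \prod_(l <- ws i) xval k l) =
    \sum_(i <- r) c i *: wd (ws i).
  elim: r => [|j r IH]; first by rewrite !big_nil.
  by rewrite !big_cons g_lin IH gw.
have := congr1 (mcoeff (ws i)) (gsum (index_enum _)); rewrite c0 g0 mcoeff0.
rewrite raddf_sum (bigD1 i) //= mcoeffZ mcoeffUU mulr1 big1 ?addr0 // => j ji.
by rewrite mcoeffZ mcoeffU (inj_eq ws_inj) (negbTE ji) mulr0.
Qed.

(** * Spanning words *)

Section Spanning.
Variables (k : fieldType) (n : nat) (Q : algType k) (v : {set 'I_n} -> Q).
Hypotheses (v0 : v set0 = 0) (v_flat : flat v setT).
Implicit Types (A B C D : {set 'I_n}) (x y z : Q).

(** The empty set is allowed as an index; since its value is 0, the span is unchanged. *)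
Definition homog (d : nat) : Q -> Prop := span (fun x =>
  exists w : seq {set 'I_n}, size w = d /\ x = \prod_(A <- w) v A).

Lemma homogM d e x y : homog d x -> homog e y -> homog (d + e) (x * y).
Proof.
move=> hx hy; elim: hx => [|c _ x' [w [sw ->]] _ IH].
  by rewrite mul0r; apply: span0.
rewrite mulrDl -scalerAl; apply: spanD => //; apply: spanZ.
elim: hy => [|c' _ y' [w' [sw' ->]] _ IH']; first by rewrite mulr0; apply: span0.
rewrite mulrDr -scalerAr; apply: spanD => //; apply: spanZ.
by apply: span_gen; exists (w ++ w'); rewrite size_cat sw sw' big_cat.
Qed.

Lemma homog1 : homog 0 1.
Proof. by apply: span_gen; exists [::]; rewrite big_nil. Qed.

Lemma homog_v A : homog 1 (v A).
Proof. by apply: span_gen; exists [:: A]; rewrite big_seq1. Qed.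

Lemma homog_chain D B j : homog j (chain v D B)`_j.
Proof.
have [m] := ubnP #|B :\: D|; elim: m => // m IH in B j *.
rewrite ltnS => ltBD; have [BD0|BD0] := eqVneq (B :\: D) set0.
  rewrite /chain BD0 cards0 /= coef1; case: j => [|j] /=; first exact: homog1.
  exact: span0.
have [i iBD ->] := chain_pick v BD0.
have lt_m : (#|(B :\ i) :\: D| < m)%N by rewrite (cardsDD1 iBD) in ltBD.
case: j => [|j]; first by rewrite coef_linM0; apply: IH.
rewrite coef_linMS; apply: spanB; first exact: IH.
by rewrite -add1n; apply: homogM; [apply: spanB; apply: homog_v | apply: IH].
Qed.

Definition acoef A j : Q := (chain v set0 A)`_j.

Lemma acoef0 A : acoef A 0 = 1. Proof. exact: coef0_chain. Qed.

Lemma acoef1 A : acoef A 1 = - v A.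
Proof. by rewrite /acoef coef1_chain ?sub0set // v0 sub0r. Qed.

Lemma acoef_gt A j : (#|A| < j)%N -> acoef A j = 0.
Proof.
by move=> lt_j; rewrite /acoef nth_default // (leq_trans (size_chain _ _ _))
  // setD0.
Qed.

Lemma homog_acoef A j : homog j (acoef A j).
Proof. exact: homog_chain. Qed.

(** * Rewriting products of two coefficients *)

Section Descent.
Variables (A C : {set 'I_n}).
Hypothesis CA : C \subset A.
Local Notation p := (chain v C A).

(** The error terms of the rewriting: they start with a(A, t) a(C, s) where t < i, and t = 0 means
    that the set C comes first. *)
Definition descend i d : Q -> Prop := span (fun x => exists t s e y,
  [/\ (t < i)%N, (0 < s)%N, (t + s + e = d)%N, homog e y
    & x = acoef A t * (acoef C s * y)]).

Lemma descend_mono i i' d x : (i <= i')%N -> descend i d x -> descend i' d x.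
Proof.
move=> le_i; apply: span_sub => _ [t [s [e [y [lt_t s0 de hy ->]]]]].
by apply: span_gen; exists t, s, e, y; rewrite (leq_trans lt_t).
Qed.

Lemma descendM i d e x z : descend i d x -> homog e z -> descend i (d + e) (x * z).
Proof.
move=> + hz; elim=> [|c _ x' [t [s [f [y [lt_t s0 <- hy ->]]]]] _ IH].
  by rewrite mul0r; apply: span0.
rewrite mulrDl -scalerAl; apply: spanD => //; apply/spanZ/span_gen.
exists t, s, (f + e)%N, (y * z).
by rewrite lt_t s0 addnA -!mulrA; split=> //; apply: homogM.
Qed.

Lemma acoef_split j : acoef A j = \sum_(t < j.+1) p`_t * acoef C (j - t).
Proof.
rewrite /acoef (chain_trans _ (sub0set C) CA) ?coefM //; exact: flatS v_flat.
Qed.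

Lemma descend_term i j t : (t < i)%N -> (t < j)%N ->
  descend t t (p`_t - acoef A t) -> descend i j (p`_t * acoef C (j - t)).
Proof.
move=> lt_i lt_j dt; rewrite -[p`_t](subrK (acoef A t)) mulrDl; apply: spanD.
  apply: (descend_mono (ltnW lt_i)); rewrite -{1}(subnKC (ltnW lt_j)).
  exact/descendM/homog_acoef.
apply: span_gen; exists t, (j - t)%N, 0%N, 1; rewrite mulr1 subn_gt0 addn0.
by rewrite subnKC ?(ltnW lt_j) //; split=> //; apply: homog1.
Qed.

(** Comparing coefficients in P_A = p P_C gives a(A, i) as p_i plus the terms
    [p_t * acoef C (i - t)] with t < i; inductively each such p_t is a(A, t) up to lower terms. *)
Lemma chain_descend i : descend i i (p`_i - acoef A i).
Proof.
have [m] := ubnP i; elim: m => // m IH in i *; rewrite ltnS => le_i.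
rewrite (acoef_split i) big_ord_recr /= subnn acoef0 mulr1 opprD addrCA subrr addr0.
apply/spanN/span_sum => t _; apply: descend_term => //.
exact/IH/(leq_trans (ltn_ord t)).
Qed.

(** As p has degree at most [#|A :\: C|], which is j, the expansion of a(A, j + l) stops at p_j a(C,
    l); then p_j is replaced by a(A, j) up to lower terms. *)
Lemma acoefM_descend j l : (0 < l)%N -> (#|C| + j = #|A|)%N ->
  descend j (j + l) (acoef A j * acoef C l - acoef A (j + l)).
Proof.
move=> l0 cardA; have p_top t : (j < t)%N -> p`_t = 0.
  move=> lt_j; rewrite nth_default // (leq_trans (size_chain _ _ _)) //.
  by rewrite cardsDS // -cardA addKn.
have -> : acoef A (j + l) =
    \sum_(t < j) p`_t * acoef C (j + l - t) + p`_j * acoef C l.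
  rewrite acoef_split -(big_mkord xpredT (fun t => p`_t * acoef C (j + l - t))).
  rewrite (big_cat_nat (n := j.+1)) //=; last by rewrite ltnS leq_addr.
  rewrite [X in _ + X]big_nat_cond [X in _ + X]big1 ?addr0; last first.
    by move=> t /andP[/andP[lt_j _] _]; rewrite p_top // mul0r.
  by rewrite big_nat_recr //= big_mkord addKn.
rewrite opprD addrCA; apply: spanD.
  apply/spanN/span_sum => t _; apply: descend_term => //.
    by rewrite (leq_trans (ltn_ord t)) // leq_addr.
  exact: chain_descend.
rewrite -mulrBl -opprB mulNr; apply/spanN/descendM; last exact: homog_acoef.
exact: chain_descend.
Qed.

End Descent.

(** * Normal words in the coefficients [acoef] span *)

Definition aletter : Type := ({set 'I_n} * 'I_n.+1)%type.
HB.instance Definition _ := Finite.on aletter.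

Definition avalid (l : aletter) : bool := (0 < l.2 <= #|l.1|)%N.

Definition afits (l : aletter) (w : seq aletter) : bool :=
  if w is l' :: _ then
    ~~ ((l'.1 \subset l.1) && (#|l'.1| + l.2 == #|l.1|)%N)
  else true.

Definition aval (l : aletter) : Q := acoef l.1 l.2.

Definition head_rank (r : nat) (w : seq aletter) : bool :=
  if w is l :: _ then (#|l.1| <= r)%N else true.

(** The bound r on the size of the first set is what guarantees that a further letter can be put in
    front. *)
Definition nspan (d r : nat) : Q -> Prop := span (fun x => exists w,
  [/\ normal afits w, all avalid w, (\sum_(l <- w) l.2 = d)%N, head_rank r w
    & x = \prod_(l <- w) aval l]).

Lemma nspan_mono d r r' x : (r <= r')%N -> nspan d r x -> nspan d r' x.
Proof.
move=> le_r; apply: span_sub => _ [w [nw vw <- hw ->]].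
apply: span_gen; exists w; split=> //; case: w hw {nw vw} => //= l w.
by move/leq_trans; apply.
Qed.

(** A forbidden pair needs the next set to have exactly [#|A| - j] elements, which exceeds r. *)
Lemma nspan_cons d r A j x : (0 < j <= #|A|)%N -> (r + j < #|A|)%N ->
  nspan d r x -> nspan (j + d) #|A| (acoef A j * x).
Proof.
move=> /andP[j0 jA] rj; have ltj : (j < n.+1)%N.
  by rewrite ltnS (leq_trans jA) // -[n in leqRHS]card_ord max_card.
elim=> [|c _ x' [w [nw vw <- hw ->]] _ IH]; first by rewrite mulr0; apply: span0.
rewrite mulrDr -scalerAr; apply: spanD => //; apply/spanZ/span_gen.
exists ((A, Ordinal ltj) :: w);
  rewrite !big_cons normal_cons nw /= vw /avalid /= j0 jA.
split=> //; case: w hw {nw vw IH} => //= l w hw; rewrite andbT negb_and;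
  apply/orP; right.
by rewrite ltn_eqF // (leq_ltn_trans _ rj) // leq_add2r.
Qed.

(** The claim is assumed only up to degree d, so that this can be used inside the induction that
    proves it. *)
Lemma homog_nspan_of d : (forall e A j x, (e <= d)%N -> (0 < j <= e)%N ->
     nspan (e - j) n x -> nspan e #|A| (acoef A j * x)) ->
  forall e x, (e <= d)%N -> homog e x -> nspan e n x.
Proof.
move=> claim; elim=> [|e IH] x le_e.
  apply: span_sub => _ [w [/size0nil-> ->]]; rewrite big_nil.
  by apply: span_gen; exists [::]; rewrite !big_nil.
apply: span_sub => _ [[|A w] [//= [sw] ->]].
rewrite big_cons -[v A]opprK -acoef1 mulNr; apply: spanN.
apply: (@nspan_mono _ #|A|); first by rewrite -[n in leqRHS]card_ord max_card.
apply: claim => //; rewrite subSS subn0; apply: IH; first exact: ltnW.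
by apply: span_gen; exists w.
Qed.

(** Nested induction on the degree d, the size of A, and d - j. A forbidden pair is rewritten by
    [acoefM_descend], and every resulting term is smaller in one of these measures. *)
Lemma nspan_acoefM d A j x : (0 < j <= d)%N ->
  nspan (d - j) n x -> nspan d #|A| (acoef A j * x).
Proof.
have [m] := ubnP d; elim: m => // m IHd in d A j x *; rewrite ltnS => le_dm.
have homog_nspan e y : (e < d)%N -> homog e y -> nspan e n y.
  move=> lt_e; apply: (@homog_nspan_of e) => // e' B i z le_e' ?.
  by apply: IHd => //; rewrite (leq_ltn_trans le_e') // (leq_trans lt_e).
have [r] := ubnP #|A|; elim: r => // r IHA in A j x *; rewrite ltnS => le_Ar.
have [q] := ubnP (d - j); elim: q => // q IHj in j x *; rewrite ltnS => le_djq.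
move=> /andP[j0 le_jd].
elim=> [|c _ x' [w [nw vw ww hw ->]] _ IH]; first by rewrite mulr0; apply: span0.
rewrite mulrDr -scalerAr; apply: spanD => // {IH x'}; apply: spanZ.
have [lt_Aj|le_jA] := ltnP #|A| j.
  by rewrite acoef_gt // mul0r; apply: span0.
have ltj : (j < n.+1)%N.
  by rewrite ltnS (leq_trans le_jA) // -[n in leqRHS]card_ord max_card.
have [fw|] := boolP (afits (A, Ordinal ltj) w).
  apply: span_gen; exists ((A, Ordinal ltj) :: w).
  rewrite !big_cons normal_cons fw nw /= vw /avalid /= j0 le_jA ww subnKC //.
case: w nw vw ww hw => // -[C l] w; rewrite normal_cons /= => /andP[_ nw].
move=> /andP[/andP[/= l0 _] vw] ww _; rewrite negbK => /andP[CA /eqP /= cardA].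
rewrite !big_cons /= in ww *; rewrite mulrA /aval /=.
set y := \prod_(_ <- w) _; rewrite -/(aval _) in y *.
have le_jld : (j + l <= d)%N by rewrite -(subnKC le_jd) leq_add2l -ww leq_addr.
have wE : (\sum_(l <- w) l.2 = d - (j + l))%N by rewrite subnDA -ww addKn.
have ny : nspan (d - (j + l)) n y.
  apply: span_gen; exists w; split=> //; case: (w) => //= l' _.
  by rewrite -[n in leqRHS]card_ord max_card.
have hy : homog (d - (j + l)) y.
  rewrite -wE /y; elim: (w) => [|l' w' IH]; first by rewrite !big_nil;
    apply: homog1.
  by rewrite !big_cons; apply: homogM => //; apply: homog_acoef.
have lt_CA : (#|C| < #|A|)%N by rewrite -cardA -addn1 leq_add2l.
(* The leading term a(A, j + l) has a larger index, so [IHj] applies; the other terms lie in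
   [descend]. *)
rewrite -[acoef A j * acoef C l](subrK (acoef A (j + l))) mulrDl; apply: spanD;
  last first.
  apply: IHj => //; last by rewrite addn_gt0 j0.
  by move: l0 le_jld le_djq; lia.
have := descendM (acoefM_descend CA l0 cardA) hy; rewrite subnKC //.
apply: span_sub => _ [t [s [e [z [lt_t s0 de hz ->]]]]].
have lt_ed : (e < d)%N by lia.
have nz : nspan e n z by apply: homog_nspan.
(* If t = 0 the smaller set C comes first and [IHA] applies. Otherwise [IHd] treats a(C, s) z, and t
   < j leaves room to prepend a(A, t). *)
have [t0|t0] := posnP t.
  rewrite t0 acoef0 mul1r; apply: (nspan_mono (ltnW lt_CA)).
  have es : e = (d - s)%N by lia.
  by apply: IHA; rewrite -?es ?(leq_trans lt_CA) //; lia.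
rewrite -(subnKC (_ : t <= d)%N); last by rewrite -de -addnA leq_addr.
apply: (@nspan_cons _ #|C|); first by rewrite t0 (leq_trans (ltnW lt_t)).
  by rewrite -cardA ltn_add2l.
have dt : (d - t = s + e)%N by lia.
apply: IHd; rewrite dt ?addKn // ?s0 ?leq_addr //.
by lia.
Qed.

Lemma homog_nspan d x : homog d x -> nspan d n x.
Proof.
apply: (@homog_nspan_of d) => // e A j y _ je; exact: nspan_acoefM.
Qed.

End Spanning.

(** * Counting words *)

Section SubsetSums.
Variables (R : comNzRingType) (I : finType).
Implicit Types (J K S : {set I}).

Lemma prodD_powerset (F G : I -> R) J :
  \prod_(i in J) (F i + G i) =
    \sum_(K in powerset J) (\prod_(i in K) F i) * \prod_(i in J :\: K) G i.
Proof.
pose F' i := if i \in J then F i else 0; pose G' i := if i \in J then G i else 1.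
transitivity (\prod_i (F' i + G' i)).
  by rewrite big_mkcond; apply: eq_bigr => i _; rewrite /F' /G';
    case: ifP => //; rewrite add0r.
rewrite bigA_distr (bigID (mem (powerset J))) /= [X in _ + X]big1 ?addr0.
  apply: eq_bigr => K; rewrite powersetE => /subsetP KJ.
  rewrite [in RHS]big_mkcond [X in _ * X]big_mkcond -big_split /=.
  apply: eq_bigr => i _; rewrite /F' /G' !inE.
  have [/KJ->|_] /= := boolP (i \in K); rewrite ?mulr1 // mul1r //.
move=> K; rewrite powersetE => /subsetPn[i iK iJ].
by rewrite (bigD1 i) //= iK /F' (negbTE iJ) mul0r.
Qed.

(** The system is triangular, with solution [X J = (\prod_(i in J) (1 - tau i)) * c], because
    expanding the product of the (1 - tau i) + tau i gives 1. Summing over J turns each factor into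
    (1 - tau i) + 1. *)
Lemma subset_sum_inversion (tau : I -> R) (X : {set I} -> R) (c : R) S :
    (forall J, J \subset S ->
      \sum_(K in powerset J) (\prod_(i in J :\: K) tau i) * X K = c) ->
  \sum_(J in powerset S) X J = (\prod_(i in S) (2 - tau i)) * c.
Proof.
move=> Xc.
have XE J : J \subset S -> X J = (\prod_(i in J) (1 - tau i)) * c.
  have [m] := ubnP #|J|; elim: m => // m IH in J *; rewrite ltnS => leJ JS.
  have e1 : \sum_(K in powerset J)
      (\prod_(i in K) (1 - tau i)) * \prod_(i in J :\: K) tau i = 1.
    by rewrite -prodD_powerset big1 // => i _; rewrite subrK.
  have /(etrans (Xc J JS)) : c = (\sum_(K in powerset J)
      (\prod_(i in K) (1 - tau i)) * \prod_(i in J :\: K) tau i) * c.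
    by rewrite e1 mul1r.
  rewrite mulr_suml.
  rewrite (bigD1 J) ?powersetE //= [RHS](bigD1 J) ?powersetE //= setDv !big_set0.
  rewrite mul1r mulr1 => e.
  apply: (addIr (\sum_(K in powerset J | K != J) (\prod_(i in J :\: K) tau i)
    * X K)).
  rewrite e; congr (_ + _).
  apply: eq_bigr => K /andP[]; rewrite powersetE => KJ KnJ.
  rewrite IH ?(subset_trans KJ) // ?mulrA; first by rewrite [X in X * c]mulrC.
  by rewrite (leq_trans _ leJ) // proper_card // properEneq KnJ.
transitivity (\sum_(J in powerset S) (\prod_(i in J) (1 - tau i)) * c).
  by apply: eq_bigr => J; rewrite powersetE => /XE.
rewrite -mulr_suml; congr (_ * c).
transitivity (\prod_(i in S) ((1 - tau i) + 1)); last first.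
  by apply: eq_bigr => i _; rewrite addrAC.
by rewrite prodD_powerset; apply: eq_bigr => J _; rewrite [X in _ * X]big1_eq mulr1.
Qed.

End SubsetSums.

Section PowerSeries.
Variable R : comUnitRingType.
Implicit Type f : fps R.

Lemma fps_ext f g : (forall d, f d = g d) -> f = g.
Proof. by move=> fg; apply/funext. Qed.

Lemma fpsBE f g d : (f - g) d = f d - g d. Proof. by []. Qed.
Lemma fps0E d : (0 : fps R) d = 0. Proof. by []. Qed.
Lemma fps1E d : (1 : fps R) d = (d == 0%N)%:R. Proof. by []. Qed.
Lemma fps_sumE (I : Type) (r : seq I) (P : pred I) (F : I -> fps R) d :
  (\sum_(i <- r | P i) F i) d = \sum_(i <- r | P i) F i d.
Proof. by elim/big_rec2: _ => //= i y x _ <-. Qed.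

Lemma fps_XM f d : ('t * f) d = if d is d'.+1 then f d' else 0.
Proof.
rewrite fpsME; case: d => [|d].
  by rewrite big_ord_recl big_ord0 /fps_X mul0r addr0.
rewrite big_ord_recl {1}/fps_X mul0r add0r big_ord_recl /fps_X /= mul1r subSS subn0.
by rewrite big1 ?addr0 // => i _; rewrite mul0r.
Qed.

Lemma fps_XnM f i d : ('t ^+ i * f) d = if (i <= d)%N then f (d - i)%N else 0.
Proof.
elim: i d => [|i IH] d; first by rewrite mul1r subn0.
by rewrite exprS -mulrA fps_XM; case: d => // d; rewrite IH.
Qed.

Lemma fps_unit_1subX f : (1 - 't * f : fps R) \is a GRing.unit.
Proof.
rewrite fps_unitE; suff -> : (1 - 't * f : fps R) 0%N = 1 by apply: unitr1.
by rewrite fpsBE fps_XM subr0.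
Qed.

End PowerSeries.

(** * Generating series of normal words *)

Section WordCount.
Variables (L : finType) (ok : pred L) (wt : L -> nat) (fits : L -> seq L -> bool).
Hypothesis ok_wt : forall l, ok l -> (0 < wt l)%N.
Implicit Types (w : seq L) (l : L) (P : pred (seq L)).

Definition good_word (d : nat) w : bool :=
  [&& normal fits w, all ok w & (\sum_(l <- w) wt l == d)%N].

(** Weights of admissible letters are positive, so the words of weight d have length at most d and
    can be listed. *)
Definition words (d : nat) : seq (seq L) :=
  undup [seq w <- flatten [seq [seq tval t | t <- enum {: i.-tuple L}]
                              | i <- iota 0 d.+1] | good_word d w].

Lemma words_uniq d : uniq (words d). Proof. exact: undup_uniq. Qed.

Lemma mem_words d w : (w \in words d) = good_word d w.
Proof.
rewrite mem_undup mem_filter; apply: andb_idr => /and3P[_ okw /eqP wd].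
apply/flatten_mapP; exists (size w); last first.
  by apply/mapP; exists (in_tuple w); rewrite ?mem_enum.
rewrite mem_iota /= add0n ltnS -wd; elim: w okw {wd} => [|l w IH] /=.
  by rewrite big_nil.
case/andP=> okl okw; rewrite big_cons -add1n leq_add ?ok_wt //; exact: IH.
Qed.

Lemma good_word_cons d l w : good_word d (l :: w) =
  [&& ok l, fits l w, (wt l <= d)%N & good_word (d - wt l) w].
Proof.
rewrite /good_word normal_cons /= big_cons.
case: (ok l) => /=; last by rewrite andbF.
case: (fits l w) => //=; set S := (\sum_(j <- w) wt j)%N.
case: (leqP (wt l) d) => [le_d|lt_d] /=.
  by congr [&& _, _ & _]; apply/eqP/eqP => ?; lia.
have -> : (wt l + S == d)%N = false by apply/eqP; lia.
by rewrite !andbF.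
Qed.

Definition head_is l w : bool := if w is l' :: _ then l' == l else false.

Section GeneratingFunctions.
Variable R : comUnitRingType.

Definition gf P : fps R := fun d => (count P (words d))%:R.

Lemma gf_eq P P' : (forall d w, good_word d w -> P w = P' w) -> gf P = gf P'.
Proof.
move=> PP'; apply: fps_ext => d; congr (_ %:R).
by apply: eq_in_count => w; rewrite mem_words => /PP'.
Qed.

Lemma gf_sum (I : finType) P (p : I -> pred (seq L)) :
    (forall d w, good_word d w -> P w = \sum_i p i w :> nat)%N ->
  gf P = \sum_i gf (p i).
Proof.
move=> PE; apply: fps_ext => d; rewrite fps_sumE /gf -natr_sum; congr (_ %:R).
rewrite -sum1_count big_mkcond big_seq /=.
under [RHS]eq_bigr do rewrite -sum1_count big_mkcond big_seq /=.
rewrite exchange_big /=; apply: eq_bigr => w; rewrite mem_words => /PE e.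
transitivity (P w : nat); first by case: (P w).
by rewrite e; apply: eq_bigr => i _; case: (p i w).
Qed.

Lemma gfC P : gf (predC P) = gf xpredT - gf P.
Proof.
apply: fps_ext => d; rewrite fpsBE /gf.
by rewrite count_predT -(count_predC P) natrD addrC addKr.
Qed.

Lemma gf_nil : gf (@nilp L) = 1.
Proof.
apply: fps_ext => d; rewrite fps1E /gf; congr (_ %:R).
have -> : count (@nilp L) (words d) = count_mem [::] (words d).
  by apply: eq_count => w; rewrite /= -size_eq0.
rewrite count_uniq_mem ?words_uniq // mem_words /good_word big_nil eq_sym.
by rewrite /normal; case: (d == _).
Qed.

(* The words satisfying P are the u ++ w for w satisfying P', with weights
   shifted by e. *)
Lemma gf_prefix u P P' e :
    (forall d w, good_word d (u ++ w) && P (u ++ w) =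
       [&& (e <= d)%N, good_word (d - e) w & P' w]) ->
    (forall w, P w -> prefix u w) ->
  gf P = 't ^+ e * gf P'.
Proof.
move=> uP Pu; apply: fps_ext => d; rewrite fps_XnM /gf -!size_filter.
have [le_ed|lt_de] := leqP e d; last first.
  rewrite -[RHS]/(0%:R); congr (_ %:R); apply/eqP;
    rewrite size_filter -leqn0 leqNgt -has_count.
  apply/hasPn => w; rewrite mem_words => gw; apply/negP => Pw.
  have /prefixP[w' wE] := Pu _ Pw; have := uP d w'.
  by rewrite -wE gw Pw leqNgt lt_de.
congr (_ %:R); rewrite -[RHS](size_map (cat u)); apply: perm_size.
apply: uniq_perm; first exact/filter_uniq/words_uniq.
  rewrite map_inj_uniq; first exact/filter_uniq/words_uniq.
  by move=> w w' /eqP; rewrite eqseq_cat // eqxx => /eqP.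
move=> w; rewrite mem_filter mem_words; apply/andP/mapP => [[Pw gw]|[w' ]].
  have /prefixP[w' wE] := Pu _ Pw; exists w' => //.
  have := uP d w'; rewrite -wE gw Pw le_ed /= => /esym/andP[gw' Pw'].
  by rewrite mem_filter Pw' mem_words.
rewrite mem_filter mem_words => /andP[Pw' gw'] ->; apply/andP.
by rewrite andbC uP le_ed gw'.
Qed.

Lemma gf_head l : ok l -> gf (head_is l) = 't ^+ wt l * gf (fits l).
Proof.
move=> okl; apply: (gf_prefix (u := [:: l])) => [d w|[|l' w] //= /eqP->].
  by rewrite /= eqxx andbT good_word_cons okl /= andbCA; case: (fits l w);
    rewrite ?andbT ?andbF.
by rewrite eqxx prefix0s.
Qed.

Lemma gf_head_eq0 l : ~~ ok l -> gf (head_is l) = 0.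
Proof.
move=> okl; apply: fps_ext => d; rewrite fps0E /gf -[RHS]/(0%:R); congr (_ %:R).
apply/eqP; rewrite -leqn0 leqNgt -has_count; apply/hasPn => -[|l' w] //=.
by rewrite mem_words good_word_cons => /andP[okl' _]; apply: contraNN okl => /eqP<-.
Qed.

Lemma gf_heads : gf xpredT = 1 + \sum_l gf (head_is l).
Proof.
have -> : \sum_l gf (head_is l) = gf (predC (nilp (T := L))).
  apply/esym/gf_sum => d [|l w] _ /=; first by rewrite big1.
  by rewrite (bigD1 l) //= eqxx big1 // => l'; rewrite eq_sym => /negbTE->.
by rewrite gfC gf_nil addrC subrK.
Qed.

End GeneratingFunctions.
End WordCount.

Lemma prefix_nseqS (L : finType) (l : L) e w :
  prefix (nseq e.+1 l) (nseq e l ++ w) = head_is l w.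
Proof.
elim: e => [|e IH]; last by rewrite /= eqxx.
by case: w => [|l' w] //=; rewrite prefix0s andbT eq_sym.
Qed.

(** * Counting the words of the independent family *)

Section XCount.
Variables (n : nat) (R : comUnitRingType).
Local Notation gf := (gf (@xvalid n) (fun=> 1%N) (@xfits n) R).
Local Notation good_word := (good_word (@xvalid n) (fun=> 1%N) (@xfits n)).
Local Notation W := (gf xpredT).
Implicit Types (m : 'I_n) (B D : {set 'I_n}) (w : seq (xletter n)).

Let wt_gt0 (l : xletter n) : xvalid l -> (0 < 1)%N. Proof. by []. Qed.

Lemma good_word_power d l e w : xvalid l -> head_is l w ->
  good_word d (nseq e l ++ w) = (e <= d)%N && good_word (d - e) w.
Proof.
move=> okl hw; elim: e d => [|e IH] d; first by rewrite subn0.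
rewrite -[nseq e.+1 l ++ w]/(l :: nseq e l ++ w) good_word_cons okl IH.
have -> : xfits l (nseq e l ++ w).
  case: e {IH} => [|e] /=; last by rewrite properxx andbF.
  by case: w hw => //= l' w /eqP->; rewrite properxx andbF.
have -> : (d - 1 - e = d - e.+1)%N by lia.
by rewrite andbA; congr (_ && _); case: d => // d; rewrite subn1.
Qed.

Definition xbad m B D w : bool :=
  [&& D \proper B, head_is (m, D) w & prefix (nseq #|B :\: D| (m, D)) w].

(** Deleting all but one letter of the required block (m, D)^r is a bijection onto the words
    starting with (m, D), and normality is preserved both ways by [good_word_power]. *)
Lemma gf_xbad m B D : B \subset below n m -> D \proper B ->
  gf (xbad m B D) = 't ^+ #|B :\: D|.-1 * gf (head_is (m, D)).
Proof.
move=> sB DB; have okD : xvalid (m, D) by apply: subset_trans (proper_sub DB) sB.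
have : (0 < #|B :\: D|)%N by rewrite card_gt0 setD_eq0; move: DB;
  rewrite properE => /andP[].
rewrite /xbad; case: #|B :\: D| => // e _;
  apply: (@gf_prefix _ _ _ _ wt_gt0 R (nseq e (m, D))) => [d w|w].
  rewrite DB /=; have -> : head_is (m, D) (nseq e (m, D) ++ w)
    && prefix (nseq e.+1 (m, D)) (nseq e (m, D) ++ w) = head_is (m, D) w.
    rewrite prefix_nseqS; apply: andb_idl; case: e => [|e _] //.
    by rewrite /= eqxx.
  have [hw|] := boolP (head_is _ w); last by rewrite !andbF.
  by rewrite !andbT; apply: good_word_power.
case/and3P=> _ _; rewrite -[e.+1]addn1 nseqD => /prefixP[w' ->].
by rewrite -catA prefix_prefix.
Qed.

(** The words that (m, B) does not fit are sorted by D, which the first letter determines; by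
    [gf_xbad] the class of D contributes exactly its summand on the left. *)
Lemma gf_xhead m B : B \subset below n m ->
  \sum_(D in powerset B) (\prod_(i in B :\: D) 't) * gf (head_is (m, D)) = 't * W.
Proof.
move=> sB; rewrite (bigD1 B) ?powersetE //= setDv big_set0 mul1r.
rewrite (gf_head _ wt_gt0) //= expr1.
have -> : gf (xfits (m, B)) = W - \sum_D gf (xbad m B D).
  rewrite -(@gf_sum _ _ _ _ wt_gt0 R _ (predC (xfits (m, B)))).
    by rewrite -gfC; apply: (gf_eq wt_gt0) => d w _; rewrite /= negbK.
  move=> d [|[m' D'] w] _.
    by rewrite big1 // => D _; rewrite /xbad /= andbF.
  rewrite (bigD1 D') //= big1 ?addn0 => [|D DD'].
    rewrite negbK /xbad /= xpair_eqE eqxx andbT.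
    by case: (D' \proper B); rewrite ?andbF //=; case: eqP => //= ->.
  by rewrite /xbad /= xpair_eqE (eq_sym D') (negbTE DD') !andbF.
have -> : \sum_D gf (xbad m B D) =
    \sum_(D : {set 'I_n} | D \proper B) gf (xbad m B D).
  rewrite [RHS]big_mkcond; apply: eq_bigr => D _; case: ifPn => // /negbTE DB.
  apply: fps_ext => d; rewrite fps0E /gf (@eq_count _ _ pred0) ?count_pred0 //.
  by move=> w; rewrite /xbad DB.
rewrite mulrBr mulr_sumr -[RHS]addr0 -addrA; congr (_ + _).
rewrite addrC (eq_bigl (fun D : {set 'I_n} => D \proper B)); last first.
  by move=> D; rewrite powersetE properEneq andbC.
rewrite -sumrB big1 // => D DB; rewrite gf_xbad // prodr_const.
have : (0 < #|B :\: D|)%N by rewrite card_gt0 setD_eq0; move: DB;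
  rewrite properE => /andP[].
by case: #|B :\: D| => // e _; rewrite mulrA -exprS subrr.
Qed.

Lemma card_below m : #|below n m| = m.
Proof.
rewrite cardsE -sum1_card (eq_bigl (fun i : 'I_n => (i < m)%N)) //.
by rewrite -(big_ord_widen n (fun=> 1%N)) ?sum1_card ?card_ord // ltnW.
Qed.

(** Nonempty words are sorted by their first letter (m, B). For fixed m, inversion over the subsets
    of [below m] gives (2 - t)^m t W, and the sum over m is geometric. *)
Lemma gf_xwords : W * (1 - 't * (2 - 't) ^+ n) = 1 - 't.
Proof.
have WE : W = 1 + (\sum_(m < n) (2 - 't) ^+ m) * ('t * W).
  rewrite {1}(gf_heads _ wt_gt0) mulr_suml; congr (_ + _).
  rewrite -(pair_bigA _ (fun m B => gf (head_is (m, B)))) /=; apply: eq_bigr => m _.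
  rewrite (bigID (mem (powerset (below n m)))) /= [X in _ + X]big1 ?addr0;
    last first.
    by move=> B; rewrite powersetE => nB; apply: (gf_head_eq0 _ wt_gt0).
  rewrite (@subset_sum_inversion _ _ (fun=> 't) _ ('t * W)).
    by rewrite prodr_const card_below.
  by move=> B sB; apply: gf_xhead.
have geo : (1 - 't) * (\sum_(m < n) (2 - 't) ^+ m) = (2 - 't) ^+ n - 1 :> fps R.
  by rewrite subrX1; congr (_ * _); ring.
transitivity ((1 - 't) * W + 't * W - 't * (2 - 't) ^+ n * W); first by ring.
rewrite {1}WE mulrDr mulr1 mulrA geo; ring.
Qed.

End XCount.

(** * Unions of cycles of a permutation *)

Section StableSets.
Variables (T : finType) (s : {perm T}).
Implicit Types (C : {set T}) (K J : {set {set T}}).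

Definition stable C : bool := s @: C == C.

Definition blocks C : {set {set T}} := [set O in porbits s | O \subset C].

Lemma porbits_trivIset : trivIset (porbits s).
Proof.
apply/trivIsetP => _ _ /imsetP[x _ ->] /imsetP[y _ ->] xy.
apply/pred0P => z /=; apply: contraNF xy => /andP[zx zy].
by move: zx zy; rewrite -!eq_porbit_mem => /eqP<- /eqP<-.
Qed.

Lemma stableP C : reflect (forall x, x \in C -> s x \in C) (stable C).
Proof.
apply: (iffP eqP) => [sC x xC|sC]; first by rewrite -sC imset_f.
apply/eqP; rewrite eqEcard card_imset ?leqnn ?andbT; last exact: perm_inj.
by apply/subsetP => _ /imsetP[x /sC xC ->].
Qed.

Lemma stable_porbit C x : stable C -> x \in C -> porbit s x \subset C.
Proof.
move/stableP => sC xC; apply/subsetP => y /porbitP[i ->].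
by elim: i => [|i IH]; rewrite ?expg0 ?perm1 // expgSr permM sC.
Qed.

Lemma cover_stable K : K \subset porbits s -> stable (cover K).
Proof.
move=> /subsetP KP; apply/stableP => x /bigcupP[O OK xO].
apply/bigcupP; exists O => //; have /imsetP[y _ OE] := KP _ OK.
move: xO; rewrite OE -!eq_porbit_mem => /eqP<-.
by have := porbit_perm s 1 x; rewrite expg1 => ->.
Qed.

Lemma cover_blocks C : stable C -> cover (blocks C) = C.
Proof.
move=> sC; apply/setP => x; apply/bigcupP/idP => [[O]|xC].
  by rewrite inE => /andP[_ /subsetP]; apply.
exists (porbit s x); last exact: porbit_id.
by rewrite inE imset_f //= stable_porbit.
Qed.

Lemma blocks_cover K : K \subset porbits s -> blocks (cover K) = K.
Proof.
move=> /subsetP KP; apply/setP => O; rewrite inE.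
apply/andP/idP => [[/imsetP[x _ ->] /subsetP sub]|OK]; last first.
  by split; [apply: KP | apply: bigcup_sup].
have /bigcupP[O' O'K xO'] := sub _ (porbit_id s x).
have /imsetP[y _ O'E] := KP _ O'K; move: xO'; rewrite O'E -eq_porbit_mem => /eqP->.
by rewrite -O'E.
Qed.

(** [cover] and [blocks] are inverse bijections between sets of cycles and stable sets. *)
Lemma sum_stable (V : nmodType) (F : {set T} -> V) J : J \subset porbits s ->
  \sum_(C in powerset (cover J) | stable C) F C = \sum_(K in powerset J)
    F (cover K).
Proof.
move=> JP; rewrite (reindex_onto cover blocks) => [|C /andP[_]];
  last exact: cover_blocks.
apply: eq_bigl => K; rewrite !powersetE.
apply/andP/idP => [[/andP[sK _] /eqP <-]|KJ].
  by rewrite -(blocks_cover JP); apply/subsetP => O;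
    rewrite !inE => /andP[-> /subset_trans]; apply.
have KP := subset_trans KJ JP; rewrite cover_stable // blocks_cover // eqxx andbT.
by split=> //; apply/bigcupsP => O OK; apply/bigcup_sup/(subsetP KJ).
Qed.

Lemma prod_porbits (R : comPzRingType) (x : R)
  J K : J \subset porbits s -> K \subset J ->
  \prod_(O in J :\: K) x ^+ #|O| = x ^+ #|cover J :\: cover K|.
Proof.
move=> JP KJ; have triv (L : {set {set T}})
  : L \subset porbits s -> \sum_(O in L) #|O| = #|cover L| :> nat.
  by move=> LP; apply/eqP/(trivIsetS LP)/porbits_trivIset.
rewrite cardsDS; last by apply/bigcupsP => O OK; apply/bigcup_sup/(subsetP KJ).
rewrite -!triv ?(subset_trans KJ) // [X in (X - _)%N](big_setID K)
  /= (setIidPr KJ) addKn.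
by rewrite -expr_sum.
Qed.

Lemma cover_porbits : cover (porbits s) = setT.
Proof.
by apply/setP => x; rewrite inE; apply/bigcupP; exists (porbit s x);
  rewrite ?imset_f ?porbit_id.
Qed.

End StableSets.

Lemma prod_porbits1 (T : finType) (R : comPzRingType) (F : nat -> R) :
  \prod_(O in porbits (1 : {perm T})) F #|O| = F 1%N ^+ #|T|.
Proof.
have porbit1 x : porbit (1 : {perm T}) x = [set x].
  by apply/setP => y; rewrite inE; apply/porbitP/eqP => [[i ->]|->];
    [rewrite expg1n perm1|exists 0%N; rewrite perm1].
rewrite big_imset /=; last by move=> x y _ _; rewrite !porbit1 => /set1_inj.
by under eq_bigr do rewrite porbit1 cards1; rewrite prodr_const.
Qed.

(** * Counting the words fixed by a permutation *)

Section ACount.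
Variables (n : nat) (s : {perm 'I_n}) (R : comUnitRingType).

(** A word is fixed exactly when each letter is, so fixed words are the normal words over this
    smaller alphabet. *)
Definition astable (l : aletter n) : bool := avalid l && stable s l.1.

Definition awt (l : aletter n) : nat := l.2.

Local Notation gf := (gf astable awt (@afits n) R).
Local Notation W := (gf xpredT).
Implicit Types (B C : {set 'I_n}) (w : seq (aletter n)).

Lemma astable_wt l : astable l -> (0 < awt l)%N.
Proof. by case/andP => /andP[]. Qed.

Definition head_set B w : bool := if w is l :: _ then l.1 == B else false.

Local Notation G B := (gf (head_set B)).

Lemma gf_head_set B : G B = \sum_(j < n.+1) gf (head_is (B, j)).
Proof.
apply: (gf_sum astable_wt) => d [|[C j] w] _ /=; first by rewrite big1.
rewrite (bigD1 j) //= big1 => [|j' jj'];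
  rewrite xpair_eqE /= ?eqxx ?andbT ?addn0 //.
by rewrite [j == _]eq_sym (negbTE jj') andbF.
Qed.

Lemma gf_head_set_eq0 B : ~~ stable s B || (B == set0) -> G B = 0.
Proof.
move=> nB; rewrite gf_head_set big1 // => j _; apply: (gf_head_eq0 _ astable_wt).
rewrite /astable /avalid /=; case/orP: nB => [/negbTE->|/eqP->];
  first by rewrite andbF.
by rewrite cards0 leqn0; case: (j : nat).
Qed.

Lemma gf_afits B (j : 'I_n.+1) :
  gf (afits (B, j)) = W - \sum_(C : {set 'I_n} | (C \subset B)
    && (#|C| + j == #|B|)%N) G C.
Proof.
rewrite big_mkcond; pose p (C : {set 'I_n}) w :=
  [&& C \subset B, (#|C| + j == #|B|)%N & head_set C w].
rewrite (eq_bigr (fun C : {set 'I_n} => gf (p C))) => [|C _]; last first.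
  case: ifPn => cond; last first.
    apply: fps_ext => d;
      rewrite fps0E /gf (@eq_count _ _ pred0) ?count_pred0 // => w.
    by rewrite /p andbA (negbTE cond).
  by apply: (gf_eq astable_wt) => d w _; rewrite /p andbA cond.
rewrite -(@gf_sum _ _ _ _ astable_wt R _ (predC (afits (B, j))) p).
  by rewrite -gfC; apply: (gf_eq astable_wt) => d w _; rewrite /= negbK.
move=> d [|[C l] w] _; first by rewrite big1 // => C _; rewrite /p /= !andbF.
rewrite (bigD1 C) //= big1 => [|C' CC'];
  first by rewrite negbK /p /= eqxx andbT addn0.
by rewrite /p /= (eq_sym C) (negbTE CC') !andbF.
Qed.

(** After (B, j) the excluded first sets are the C inside B with [#|B :\: C|] equal to j. Each
    proper C thus occurs for one j only, and its series moves to the left side. *)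
Lemma gf_aset B : stable s B ->
  \sum_(C in powerset B) 't ^+ #|B :\: C| * G C =
    (\sum_(j < n.+1 | (0 < j <= #|B|)%N) 't ^+ j) * W.
Proof.
move=> sB; rewrite (bigD1 B) ?powersetE //= setDv cards0 mul1r gf_head_set.
rewrite (bigID (fun j : 'I_n.+1 =>
  (0 < j <= #|B|)%N)) /= [X in _ + X + _]big1 ?addr0; last first.
  by move=> j nj; apply: (gf_head_eq0 _ astable_wt);
    rewrite /astable /avalid /= (negbTE nj).
under eq_bigr => j vj.
  rewrite (gf_head _ astable_wt) /astable /avalid /= ?vj // gf_afits /awt /= mulrBr.
  over.
rewrite sumrB -mulr_suml -[RHS]addr0 -addrA; congr (_ + _).
rewrite addrC; apply/eqP; rewrite subr_eq0; apply/eqP.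
under [RHS]eq_bigr do rewrite mulr_sumr.
rewrite (exchange_big_dep (fun C : {set 'I_n} => (C \subset B) && (C != B))) /=.
  apply: eq_big => C; first by rewrite powersetE.
  rewrite powersetE => /andP[CB CnB].
  have lt_CB : (#|C| < #|B|)%N by rewrite proper_card // properEneq CnB.
  have jlt : (#|B :\: C| < n.+1)%N by rewrite ltnS -[n in leqRHS]card_ord max_card.
  rewrite (big_pred1 (Ordinal jlt)) // => j /=; rewrite CB -val_eqE /= cardsDS //.
  move: (nat_of_ord j) #|C| #|B| lt_CB => {}j c b lt_cb.
  apply/andP/eqP => [[_ /eqP <-]|->]; first by rewrite addKn.
  by rewrite subn_gt0 lt_cb leq_subr subnKC // ltnW.
move=> j C /andP[j0 _] /andP[-> /eqP cB] /=; apply: contraTneq j0 => CB.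
by rewrite -leqNgt; move: cB; rewrite CB; lia.
Qed.

Lemma geometric b : (b <= n)%N ->
  (1 - 't) * (\sum_(j < n.+1 | (0 < j <= b)%N) 't ^+ j) = 't - 't ^+ b.+1 :> fps R.
Proof.
elim: b => [|b IH] lt_bn.
  by rewrite big_pred0 ?mulr0 ?expr1 ?subrr // => j; rewrite leqn0;
    case: (nat_of_ord j).
rewrite (bigD1 (Ordinal (lt_bn : (b.+1 < n.+1)%N))) ?leqnn //=.
rewrite mulrDr (eq_bigl (fun j : 'I_n.+1 => (0 < j <= b)%N)); last first.
  by move=> j; rewrite -val_eqE /= -andbA; congr (_ && _);
    rewrite andbC -ltn_neqAle ltnS.
by rewrite IH ?(ltnW lt_bn) //= (exprS _ b.+1); set u := 't ^+ b.+1; ring.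
Qed.

(** Stable sets are sets of cycles, so the inversion runs over cycles O with [tau O] equal to t to
    the power [#|O|]. *)
Lemma gf_awords : W * (1 - 't * \prod_(C in porbits s) (2 - 't ^+ #|C|)) = 1 - 't.
Proof.
(* The correction at the empty set makes the weighted sums independent of B: it supplies the power
   ['t ^+ #|B|.+1] that [geometric] subtracts. *)
pose X C : fps R := (1 - 't) * G C + (C == set0)%:R * ('t * W).
have XB B : stable s B ->
    \sum_(C in powerset B | stable s C) 't ^+ #|B :\: C| * X C = 't * W.
  move=> sB; have -> : \sum_(C in powerset B | stable s C) 't ^+ #|B :\: C| * X C =
      \sum_(C in powerset B) 't ^+ #|B :\: C| * X C.
    rewrite [RHS](bigID (stable s)) /= [X in _ + X]big1 ?addr0 // => C /andP[_ nC].
    rewrite /X gf_head_set_eq0 ?nC // mulr0 add0r.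
    have [C0|] := eqVneq; last by rewrite mul0r mulr0.
    by case/negP: nC; rewrite C0; apply/stableP => x; rewrite inE.
  under eq_bigr do rewrite mulrDr mulrCA.
  rewrite big_split /= -mulr_sumr gf_aset // mulrA geometric; last first.
    by rewrite -[n in leqRHS]card_ord max_card.
  rewrite (bigD1 set0) ?powersetE ?sub0set //= eqxx big1 ?addr0 =>
    [|C /andP[_ /negbTE->]].
    by rewrite setD0 mul1r exprSr; ring.
  by rewrite mul0r mulr0.
have : \sum_(J in powerset (porbits s)) X (cover J) =
    (\prod_(O in porbits s) (2 - 't ^+ #|O|)) * ('t * W).
  apply: subset_sum_inversion => J JP.
  rewrite -(XB _ (cover_stable JP)) sum_stable //.
  by apply: eq_bigr => K; rewrite powersetE => KJ; rewrite (prod_porbits _ JP).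
rewrite -(sum_stable _ (subxx _)) cover_porbits.
have -> : \sum_(C in powerset setT | stable s C) X C = \sum_C X C.
  rewrite [RHS](bigID (stable s)) /= [X in _ + X]big1 ?addr0.
    by apply: eq_bigl => C; rewrite powersetE subsetT.
  move=> C nC; rewrite /X gf_head_set_eq0 ?nC // mulr0 add0r.
  have [C0|] := eqVneq; last by rewrite mul0r.
  by case/negP: nC; rewrite C0; apply/stableP => x; rewrite inE.
rewrite /X big_split /= -mulr_sumr.
have -> : \sum_C G C = W - 1.
  rewrite (gf_heads _ astable_wt) addrC addKr.
  rewrite -(pair_bigA _ (fun B j => gf (head_is (B, j)))) /=.
  by apply: eq_bigr => B _; apply: gf_head_set.
rewrite (bigD1 set0) //= eqxx big1 ?addr0 ?mul1r => [e|C /negbTE->];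
  last by rewrite mul0r.
transitivity (W - (\prod_(O in porbits s) (2 - 't ^+ #|O|)) * ('t * W));
  first by ring.
rewrite -e; ring.
Qed.

End ACount.

(** * The basis and the trace *)

Lemma lin_comb_mulmx (k : comNzRingType) (V : lmodType k) p q (x : 'I_p -> V)
    (y : 'I_q -> V) (P : 'M[k]_(p, q)) (u : 'rV[k]_p) :
    (forall i, x i = \sum_j P i j *: y j) ->
  \sum_i u 0 i *: x i = \sum_j (u *m P) 0 j *: y j.
Proof.
move=> PE; under eq_bigr do rewrite PE scaler_sumr.
rewrite exchange_big; apply: eq_bigr => j _ /=.
by rewrite mxE scaler_suml; apply: eq_bigr => i _; rewrite scalerA.
Qed.

Section Basis.
Variables (k : fieldType) (n : nat).
Local Notation Q := (Qn k n).
Local Notation v := (@Qv k n).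
Local Notation homog := (homog v).
Local Notation aval := (aval v).

Let vflat : flat v setT := @Qv_flat k n setT.

Lemma Qdeg_lin d (c : k) (x y : Q) :
  Qdeg d x -> Qdeg d y -> Qdeg d (c *: x + y).
Proof.
move=> [a ->] [b ->]; exists (fun w => c * a w + b w).
rewrite scaler_sumr -big_split /=; apply: eq_bigr => w _.
by rewrite scalerDl scalerA.
Qed.

(** The words allowed in [homog] but not in [Qdeg] contain the empty set and vanish. *)
Lemma Qdeg_homog d (x : Q) : Qdeg d x <-> homog d x.
Proof.
split=> [[c ->]|].
  apply: span_sum => w _; apply/spanZ/span_gen.
  by exists (map val w); rewrite size_map size_tuple big_map.
have Qdeg0 : Qdeg d (0 : Q).
  by exists (fun=> 0); rewrite big1 // => w _; rewrite scale0r.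
elim=> [//|c _ y [w [<- ->]] _]; apply: Qdeg_lin.
have [w0|w0] := boolP (set0 \in w).
  rewrite (_ : \prod_(_ <- _) _ = 0); first by exists (fun=> 0);
    rewrite big1 // => u _; rewrite scale0r.
  elim: w w0 {y Qdeg0} => // A w IH; rewrite inE big_cons.
  by case/predU1P=> [<-|/IH->]; rewrite ?Qv0 ?mul0r ?mulr0.
have [u uw] : exists u : seq (Qgen n), map val u = w.
  elim: w w0 {y Qdeg0} => [|A w IH]; first by exists [::].
  rewrite inE negb_or eq_sym => /andP[A0 /IH[u <-]].
  by exists ((exist _ A A0 : Qgen n) :: u).
have su : size u == size w by rewrite -uw size_map.
exists (fun t => (t == Tuple su)%:R).
rewrite (bigD1 (Tuple su)) //= eqxx scale1r [X in _ + X]big1 ?addr0; last first.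
  by move=> t /negbTE->; rewrite scale0r.
by rewrite -[in LHS]uw big_map.
Qed.

Lemma homog_aword (w : seq (aletter n)) :
  homog (\sum_(l <- w) l.2)%N (\prod_(l <- w) aval l).
Proof.
elim: w => [|l w IH]; first by rewrite !big_nil; apply: homog1.
by rewrite !big_cons; apply: homogM => //; apply: homog_acoef.
Qed.

Lemma homog_xword (w : seq (xletter n)) : homog (size w) (\prod_(l <- w) xval k l).
Proof.
elim: w => [|l w IH]; first by rewrite big_nil; apply: homog1.
rewrite big_cons -[size _]add1n; apply: homogM => //.
by apply: spanB; apply: homog_v.
Qed.

Definition awords d := words (@astable n 1%g) (@awt n) (@afits n) d.
Definition xwords d := words (@xvalid n) (fun=> 1%N) (@xfits n) d.

(** The identity has n cycles of length 1, so both series solve the same equation with a unit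
    factor. Over the integers, equal coefficients mean equal sizes. *)
Lemma size_awords d : size (awords d) = size (xwords d).
Proof.
have : gf (@astable n 1%g) (@awt n) (@afits n) int xpredT =
       gf (@xvalid n) (fun=> 1%N) (@xfits n) int xpredT.
  apply: (mulIr (fps_unit_1subX ((2 - 't) ^+ n))).
  rewrite gf_xwords -(gf_awords (1%g : {perm 'I_n})); congr (_ * (1 - 't * _)).
  by rewrite (prod_porbits1 _ (fun i => 2 - 't ^+ i)) card_ord expr1.
move=> /(congr1 (fun f : fps int => f d)); rewrite /gf !count_predT.
by rewrite !natz => -[].
Qed.

Lemma stable1 (C : {set 'I_n}) : stable 1%g C.
Proof. by apply/stableP => x; rewrite perm1. Qed.

Lemma mem_awords d w : (w \in awords d) =
  good_word (@avalid n) (@awt n) (@afits n) d w.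
Proof.
rewrite mem_words; last exact: astable_wt; congr [&& _, _ & _].
by apply: eq_all => l; rewrite /astable stable1 andbT.
Qed.

Section Degree.
Variable d : nat.
Local Notation m := (size (awords d)).

Definition aword (i : 'I_m) : seq (aletter n) := nth [::] (awords d) i.
Definition abasis (i : 'I_m) : Q := \prod_(l <- aword i) aval l.

Lemma aword_good i : good_word (@avalid n) (@awt n) (@afits n) d (aword i).
Proof. by rewrite -mem_awords mem_nth. Qed.

Lemma aword_inj : injective aword.
Proof.
move=> i j /eqP; rewrite nth_uniq ?words_uniq // => /eqP; exact: val_inj.
Qed.

Lemma abasis_span x : homog d x -> exists c : 'rV[k]_m, x = \sum_i c 0 i *:
  abasis i.
Proof.
move/(homog_nspan (Qv0 k n) vflat).
elim=> [|a _ y [w [nw vw dw _ ->]] _ [c ->]].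
  by exists 0; rewrite big1 // => i _; rewrite mxE scale0r.
have lt_w : (index w (awords d) < m)%N.
  by rewrite index_mem mem_awords /good_word nw vw; apply/eqP.
exists (a *: delta_mx 0 (Ordinal lt_w) + c).
under [RHS]eq_bigr do rewrite !mxE eqxx /= scalerDl.
rewrite big_split /=; congr (_ + _).
rewrite (bigD1 (Ordinal lt_w)) //= eqxx mulr1 [X in _ + X]big1 ?addr0; last first.
  by move=> i /negbTE->; rewrite mulr0 scale0r.
by rewrite /abasis /aword nth_index // -index_mem.
Qed.

(** A spanning family as large as an independent one is independent: the square matrix P expressing
    the words [xb] through [abasis] has trivial kernel, hence is invertible. *)
Lemma abasis_free (c : 'rV[k]_m) : \sum_i c 0 i *: abasis i = 0 -> c = 0.
Proof.
pose xw (i : 'I_m) : seq (xletter n) := nth [::] (xwords d) i.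
pose xb i : Q := \prod_(l <- xw i) xval k l.
have xw_good i : good_word (@xvalid n) (fun=> 1%N) (@xfits n) d (xw i).
  by rewrite -mem_words // mem_nth // -size_awords.
have xw_inj : injective xw.
  move=> i j /eqP; rewrite nth_uniq ?words_uniq -?size_awords // => /eqP.
  exact: val_inj.
have hx i : homog d (xb i).
  have /and3P[_ _ /eqP] := xw_good i; rewrite sum1_size => <-.
  exact: homog_xword.
have [P PE] : exists P : 'M[k]_m, forall i, xb i = \sum_j P i j *: abasis j.
  pose r i := sval (cid (abasis_span (hx i))).
  exists (\matrix_(i, j) r i 0 j) => i.
  rewrite (svalP (cid (abasis_span (hx i)))).
  by apply: eq_bigr => j _; rewrite mxE.
have comb (u : 'rV[k]_m) :
    \sum_i u 0 i *: xb i = \sum_j (u *m P) 0 j *: abasis j.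
  exact: lin_comb_mulmx.
have x_free (u : 'rV[k]_m) : \sum_i u 0 i *: xb i = 0 -> u = 0.
  move=> u0; apply/rowP => i; rewrite mxE.
  apply: (@xword_free k n m xw (fun i => u 0 i)) => // j.
    by have /and3P[] := xw_good j.
  by have /and3P[] := xw_good j.
have Pu : P \in unitmx.
  rewrite -row_free_unit -kermx_eq0; apply/rowV0P => u /sub_kermxP uP.
  by apply: x_free; rewrite comb uP big1 // => i _; rewrite mxE scale0r.
move=> c0; rewrite -[c](mulmxKV Pu) (_ : c *m invmx P = 0) ?mul0mx //.
by apply: x_free; rewrite comb mulmxKV.
Qed.

Lemma abasis_is_basis : is_basis (@Qdeg k n d) abasis.
Proof.
split=> [i|x /Qdeg_homog|]; [|exact: abasis_span|exact: abasis_free].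
apply/Qdeg_homog; have /and3P[_ _ /eqP] := aword_good i.
by rewrite /awt => <-; apply: homog_aword.
Qed.

(** * The action on the basis and its trace *)

Variable s : {perm 'I_n}.

Definition aact (l : aletter n) : aletter n := (s @: l.1, l.2).

Lemma Qact_aval l : Qact s (aval l) = aval (aact l).
Proof.
have e := @map_chain _ Q Q (Qact s) s v v set0 l.1 (@Qact_v k n s)
  (@Qv_flat k n _) (sub0set _).
by rewrite /aval /acoef /aact /= -[in RHS](imset0 s) -e coef_map.
Qed.

Lemma aact_good w : good_word (@avalid n) (@awt n) (@afits n) d w ->
  good_word (@avalid n) (@awt n) (@afits n) d (map aact w).
Proof.
have cards (A : {set 'I_n}) : #|s @: A| = #|A| by apply/card_imset/perm_inj.
move=> /and3P[nw vw dw]; apply/and3P; split; last by rewrite big_map.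
  elim: w nw {vw dw} => // l w IH; rewrite /= !normal_cons => /andP[fw /IH->].
  rewrite andbT; case: w fw {IH} => //= l' w; rewrite !cards; apply: contra.
  case/andP=> /subsetP sub ->; rewrite andbT; apply/subsetP => x xl.
  by have := sub _ (imset_f s xl); rewrite mem_imset //; apply: perm_inj.
by rewrite all_map; apply: sub_all vw => l; rewrite /avalid /= cards.
Qed.

(** The basis is permuted, so the matrix is a permutation matrix and its trace counts the fixed
    words. *)
Lemma trace_Qact : trace_on (@Qdeg k n d) (Qact s) =
  (size (words (astable s) (@awt n) (@afits n) d))%:R.
Proof.
pose M : 'M[k]_m := \matrix_(i, j) (aword j == map aact (aword i))%:R.
rewrite (@trace_onE _ _ _ (Qact s) _ _ M abasis_is_basis) => [|i].
  have -> : size (words (astable s) (@awt n) (@afits n) d) =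
      count (fun w => map aact w == w) (awords d).
    rewrite -size_filter; apply: perm_size; apply: uniq_perm.
    - exact: words_uniq.
    - exact/filter_uniq/words_uniq.
    move=> w; rewrite mem_filter mem_awords mem_words; last exact: astable_wt.
    suff e : all (@astable n s) w = (map aact w == w) && all (@avalid n) w.
      by rewrite /good_word e; case: (normal _ _); case: eqP; case: (all _ _).
    elim: w => //= -[A j] w ->; rewrite eqseq_cons xpair_eqE eqxx andbT.
    rewrite /astable /stable /=.
    by case: (avalid _); case: (_ @: A == A); rewrite ?andbT ?andbF //=.
  rewrite -sum1_count big_mkcond (big_nth [::]) big_mkord natr_sum.
  apply: eq_bigr => i _; rewrite mxE eq_sym /aword.
  by case: eqP.
have lt_w : (index (map aact (aword i)) (awords d) < m)%N.
  by rewrite index_mem mem_awords aact_good ?aword_good.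
have wE : aword (Ordinal lt_w) = map aact (aword i).
  by rewrite /aword nth_index // -index_mem.
rewrite (bigD1 (Ordinal lt_w))
  //= mxE wE eqxx scale1r [X in _ + X]big1 ?addr0 => [|j ji].
  rewrite /abasis wE big_map rmorph_prod; apply: eq_bigr => l _; exact: Qact_aval.
by rewrite mxE -wE (inj_eq aword_inj) (negbTE ji) scale0r.
Qed.

End Degree.
End Basis.

Theorem theorem6p1 (k : fieldType) (n : nat) (s : {perm 'I_n})
    (char0 : [pchar k] =i pred0) :
  graded_trace k s =
    (1 - 't) / (1 - 't * \prod_(C in porbits s) (2 - 't ^+ #|C|)).
Proof.
(* The numerator becomes the series of fixed words times the denominator, which is a unit with
   constant coefficient 1. *)
rewrite -(gf_awords s k) mulrK ?fps_unit_1subX //.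
by apply: fps_ext => d; rewrite /graded_trace trace_Qact /gf count_predT.
Qed.
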